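(* Let $\boldsymbol{\lambda},\boldsymbol{\mu}\in\mathcal{P}_+$ be such that at least one of them lies sufficiently deep in the dominant cone. Then the Bernstein-Szegő polynomials are orthogonal: $$\langle p_{\boldsymbol{\lambda}},p_{\boldsymbol{\mu}}\rangle_{\Delta}=0\quad\text{if}\quad\boldsymbol{\mu}\neq\boldsymbol{\lambda}.$$
   Context: Root system. $\mathbf{E}$ is a real finite-dimensional Euclidean vector space with scalar product $\langle\cdot,\cdot\rangle$, and $\mathbf{R}$ is an irreducible, reduced, crystallographic root system spanning $\mathbf{E}$, with a fixed choice of positive roots $\mathbf{R}_+$. Write $\boldsymbol{\alpha}^\vee:=2\boldsymbol{\alpha}/\langle\boldsymbol{\alpha},\boldsymbol{\alpha}\rangle$, $\mathbf{R}^\vee=\{\boldsymbol{\alpha}^\vee\mid\boldsymbol{\alpha}\in\mathbf{R}\}$, $\mathcal{Q}^\vee=\mathrm{Span}_{\mathbb{Z}}(\mathbf{R}^\vee)$, $\mathcal{Q}_+=\mathrm{Span}_{\mathbb{N}}(\mathbf{R}_+)$ (with $0\in\mathbb{N}$), $\mathcal{P}=\{\boldsymbol{\lambda}\in\mathbf{E}\mid\langle\boldsymbol{\lambda},\boldsymbol{\alpha}^\vee\rangle\in\mathbb{Z}\ \forall\boldsymbol{\alpha}\in\mathbf{R}\}$ (weight lattice), $\mathcal{P}_+=\{\boldsymbol{\lambda}\in\mathcal{P}\mid\langle\boldsymbol{\lambda},\boldsymbol{\alpha}^\vee\rangle\in\mathbb{N}\ \forall\boldsymbol{\alpha}\in\mathbf{R}_+\}$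 (dominant weights). $W$ is the Weyl group generated by the orthogonal reflections in the hyperplanes perpendicular to the roots, and $\mathbf{x}_w:=w(\mathbf{x})$. $\mathbf{R}^{(s)}$ and $\mathbf{R}^{(l)}$ are the short and long roots (if $\mathbf{R}$ is simply-laced all roots are short and $\mathbf{R}^{(l)}=\emptyset$), $\mathbf{R}_+^{(s)}=\mathbf{R}^{(s)}\cap\mathbf{R}_+$, $\mathbf{R}_+^{(l)}=\mathbf{R}^{(l)}\cap\mathbf{R}_+$. Dominance order: $\boldsymbol{\mu}\preceq\boldsymbol{\lambda}$ iff $\boldsymbol{\lambda}-\boldsymbol{\mu}\in\mathcal{Q}_+$ (and $\prec$ means $\preceq$ and $\neq$). Weight function. $M^{(s)},M^{(l)}$ are nonnegative integers, the parameters $t_m^{(s)}$ ($1\le m\le M^{(s)}$) and $t_m^{(l)}$ ($1\le m\le M^{(l)}$) lie in $(-1,1)\setminus\{0\}$, $c^{(s)}(z)=\prod_{m=1}^{M^{(s)}}(1+t_m^{(s)}z)$, $c^{(l)}(z)=\prod_{m=1}^{M^{(l)}}(1+t_m^{(l)}z)$ (empty products equal one), and $$\delta(\mathbf{x})=\prod_{\boldsymbol{\alpha}\in\mathbf{R}_+}\bigl(e^{i\langle\boldsymbol{\alpha},\mathbf{x}\rangle/2}-e^{-i\langle\boldsymbol{\alpha},\mathbf{x}\rangle/2}\bigr),\quad C(\mathbf{x})=\prod_{\boldsymbol{\alpha}\in\mathbf{R}_+^{(s)}}c^{(s)}(e^{-i\langle\boldsymbol{\alpha},\mathbf{x}\rangle})\prod_{\boldsymbol{\alpha}\in\mathbf{R}_+^{(l)}}c^{(l)}(e^{-i\langle\boldsymbol{\alpha},\mathbf{x}\rangle}),\quad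 \Delta(\mathbf{x})=\frac{|\delta(\mathbf{x})|^2}{C(\mathbf{x})C(-\mathbf{x})}.$$ Polynomials. For $\boldsymbol{\lambda}\in\mathcal{P}_+$, $m_{\boldsymbol{\lambda}}(\mathbf{x})=\frac{1}{|W_{\boldsymbol{\lambda}}|}\sum_{w\in W}e^{i\langle\boldsymbol{\lambda},\mathbf{x}_w\rangle}$, where $W_{\boldsymbol{\lambda}}=\{w\in W\mid w(\boldsymbol{\lambda})=\boldsymbol{\lambda}\}$; these form a basis of the algebra $\boldsymbol{A}_{\mathbf{R}}$ of $W$-invariant trigonometric polynomials on the torus $\mathbb{T}_{\mathbf{R}}=\mathbf{E}/(2\pi\mathcal{Q}^\vee)$. Inner product on $\boldsymbol{A}_{\mathbf{R}}$: $\langle f,g\rangle_\Delta=\frac{1}{|W|\,\mathrm{Vol}(\mathbb{T}_{\mathbf{R}})}\int_{\mathbb{T}_{\mathbf{R}}}f(\mathbf{x})\overline{g(\mathbf{x})}\Delta(\mathbf{x})\,d\mathbf{x}$, with $\mathrm{Vol}(\mathbb{T}_{\mathbf{R}})=\int_{\mathbb{T}_{\mathbf{R}}}d\mathbf{x}$. The monic Bernstein-Szegő polynomial $p_{\boldsymbol{\lambda}}$, $\boldsymbol{\lambda}\in\mathcal{P}_+$, is the unique polynomial of the form $p_{\boldsymbol{\lambda}}=\sum_{\boldsymbol{\mu}\in\mathcal{P}_+,\,\boldsymbol{\mu}\preceq\boldsymbol{\lambda}}a_{\boldsymbol{\lambda}\boldsymbol{\mu}}m_{\boldsymbol{\mu}}$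 with $a_{\boldsymbol{\lambda}\boldsymbol{\mu}}\in\mathbb{C}$, $a_{\boldsymbol{\lambda}\boldsymbol{\lambda}}=1$, and $\langle p_{\boldsymbol{\lambda}},m_{\boldsymbol{\mu}}\rangle_\Delta=0$ for all $\boldsymbol{\mu}\in\mathcal{P}_+$ with $\boldsymbol{\mu}\prec\boldsymbol{\lambda}$. Depth. $m^{(s)}(\boldsymbol{\lambda})=\min_{\boldsymbol{\alpha}\in\mathbf{R}_+^{(s)}}\langle\boldsymbol{\lambda},\boldsymbol{\alpha}^\vee\rangle$, $m^{(l)}(\boldsymbol{\lambda})=\min_{\boldsymbol{\alpha}\in\mathbf{R}_+^{(l)}}\langle\boldsymbol{\lambda},\boldsymbol{\alpha}^\vee\rangle$. A weight $\boldsymbol{\lambda}\in\mathcal{P}_+$ is sufficiently deep in the dominant cone iff $m^{(s)}(\boldsymbol{\lambda})\ge M^{(s)}-1$ and $m^{(l)}(\boldsymbol{\lambda})\ge M^{(l)}-1$ (if $\mathbf{R}$ is simply-laced, the second condition is vacuous). *)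

(* Defs.v *)
From HB Require Import structures.
From mathcomp Require Import all_boot all_order all_algebra finmap.
From mathcomp Require Import complex.
From mathcomp Require Import all_classical all_reals all_analysis.

Set Implicit Arguments.
Unset Strict Implicit.
Unset Printing Implicit Defensive.

Import Order.TTheory GRing.Theory Num.Theory.

Local Open Scope classical_set_scope.
Local Open Scope fset_scope.
Local Open Scope complex_scope.
Local Open Scope ring_scope.

Section RootSystems.
Context {R : realType} {E : vectType R}.
Variables (ip : {dot E for idfun}) (Rt Rp : {fset E}).

Definition coroot (alpha : E) : E := (2 / ip alpha alpha) *: alpha.

Definition reflection (alpha : E) : 'End(E) :=
  linfun (fun x : E => x - ip x (coroot alpha) *: alpha).

Record root_system : Prop := RootSystem {
  roots_span : (<<enum_fset Rt>> = fullv)%VS;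
  roots_neq0 : 0 \notin Rt;
  roots_refl : forall alpha beta, alpha \in Rt -> beta \in Rt ->
    reflection alpha beta \in Rt;
  roots_crystallographic : forall alpha beta, alpha \in Rt -> beta \in Rt ->
    ip beta (coroot alpha) \is a Num.int;
  roots_reduced : forall (alpha : E) (c : R), alpha \in Rt ->
    c *: alpha \in Rt -> c = 1 \/ c = -1 }.

Definition irreducible_roots : Prop :=
  Rt != fset0 /\
  forall A : {fset E}, A `<=` Rt ->
    (forall alpha beta, alpha \in A -> beta \in Rt `\` A ->
       ip alpha beta = 0) ->
    A = fset0 \/ A = Rt.

Definition positive_roots : Prop :=
  exists v : E, (forall alpha, alpha \in Rt -> ip alpha v != 0) /\
    Rp = [fset alpha in Rt | 0 < ip alpha v].

(* All roots are short when Rt is simply laced. *)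
Definition short_root (alpha : E) : bool :=
  (alpha \in Rt) && all (fun beta => ip alpha alpha <= ip beta beta) Rt.

Definition long_root (alpha : E) : bool :=
  (alpha \in Rt) && ~~ short_root alpha.

Definition pos_short : {fset E} := [fset alpha in Rp | short_root alpha].
Definition pos_long : {fset E} := [fset alpha in Rp | long_root alpha].

(* Reflections are involutions, so closure under inverses is automatic. *)
Inductive weyl : 'End(E) -> Prop :=
| weyl_id : weyl \1%VF
| weyl_refl alpha w : alpha \in Rt -> weyl w -> weyl (reflection alpha \o w)%VF.

Definition weyl_group : set 'End(E) := [set w | weyl w].

Definition stabilizer (lam : E) : set 'End(E) :=
  [set w | weyl w /\ w lam = lam].

Definition weight (lam : E) : Prop :=
  forall alpha, alpha \in Rt -> ip lam (coroot alpha) \is a Num.int.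

Definition dominant (lam : E) : Prop :=
  weight lam /\
  forall alpha, alpha \in Rp -> ip lam (coroot alpha) \is a Num.nat.

Definition root_cone (x : E) : Prop :=
  exists k : E -> nat, x = \sum_(alpha <- Rp) alpha *+ k alpha.

Definition dominance_le (mu lam : E) : Prop := root_cone (lam - mu).
Definition dominance_lt (mu lam : E) : Prop :=
  dominance_le mu lam /\ mu <> lam.

Definition coroot_lattice (x : E) : Prop :=
  exists k : E -> int, x = \sum_(alpha <- Rt) coroot alpha *~ k alpha.

(* The minimum over the empty set is +oo. *)
Definition min_pairing (A : {fset E}) (lam : E) : \bar R :=
  \big[Order.min/+oo%E]_(alpha <- A) (ip lam (coroot alpha))%:E.

Definition depth_short (lam : E) : \bar R := min_pairing pos_short lam.
Definition depth_long (lam : E) : \bar R := min_pairing pos_long lam.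

Definition sufficiently_deep (Ms Ml : nat) (lam : E) : Prop :=
  ((Ms%:R - 1)%:E <= depth_short lam)%E /\ ((Ml%:R - 1)%:E <= depth_long lam)%E.

Definition lattice_basis (b : (\dim {:E}).-tuple E) : Prop :=
  basis_of fullv b /\
  forall x, coroot_lattice x <->
    exists k : 'I_(\dim {:E}) -> int, x = \sum_i tnth b i *~ k i.

Definition coroot_basis : (\dim {:E}).-tuple E :=
  xget [tuple 0 | _ < \dim {:E}] [set b | lattice_basis b].

End RootSystems.

Section CorootBasis.
Context {R : realType} {E : vectType R}.
Variables (ip : {dot E for idfun}) (Rt : {fset E}).

Lemma dot_roots_eq0 (x : E) : root_system ip Rt ->
  (forall alpha, alpha \in Rt -> ip alpha x = 0) -> x = 0.
Proof.
move=> rs x0; apply/eqP/negPn/negP => xn.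
have := neq0_dnorm_gt0 (s := ip) x xn.
have xR : x \in (<<in_tuple (enum_fset Rt)>>)%VS.
  by rewrite (roots_span rs) memvf.
rewrite {1}(coord_span xR) -applyrE linear_sum /= big1 ?ltxx// => i _.
by rewrite linearZl_LR /= x0 ?mulr0// mem_nth.
Qed.

Lemma lattice_basis_exists : root_system ip Rt ->
  exists b : (\dim {:E}).-tuple E, lattice_basis ip Rt b.
Proof.
move=> rs; set N := size (enum_fset Rt).
pose r (k : 'I_N) : E := nth 0 (enum_fset Rt) k.
have rR k : r k \in Rt by apply: mem_nth.
pose c k := coroot ip (r k).
pose M : 'M[int]_N := \matrix_(k, l) Num.floor (ip (r l) (c k)).
have ME k l : (M k l)%:~R = ip (r l) (c k).
  by rewrite mxE; apply/eqP; rewrite -intrEfloor (roots_crystallographic rs).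
have [L uL [U uU [d _ MLDU]]] := int_Smith_normal_form M.
set D := \matrix_(i, j) _ in MLDU.
pose L' := invmx L.
pose b' (j : 'I_N) : E := \sum_k c k *~ L' j k.
pose dj (j : 'I_N) : int := d`_j.
have pair_b' l j : ip (r l) (b' j) = (dj j * U j l)%:~R.
  have -> : dj j * U j l = (L' *m M) j l.
    rewrite MLDU -mulmxA mulKmx// mxE (bigD1 j)//= big1 ?addr0 ?mxE ?eqxx ?mulr1n//.
    by move=> i ij; rewrite mxE -val_eqE eq_sym in ij *; rewrite (negPf ij) mulr0n mul0r.
  rewrite mxE rmorph_sum linear_sumr /=; apply: eq_bigr => k _.
  by rewrite rmorphM/= ME -scaler_int linearZr_LR.
have cE k : c k = \sum_j b' j *~ L k j.
  transitivity (\sum_l c l *~ (L *m L') k l).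
    rewrite mulmxV// (bigD1 k)//= big1 ?addr0 ?mxE ?eqxx// => l lk.
    by rewrite mxE eq_sym (negPf lk).
  under eq_bigr do rewrite mxE mulrz_sumr.
  rewrite exchange_big; apply: eq_bigr => j _ /=.
  rewrite mulrz_suml; apply: eq_bigr => l _.
  by rewrite -mulrzA mulrC.
have b'0 j : dj j = 0 -> b' j = 0.
  move=> dj0; apply: (dot_roots_eq0 rs) => a /(nthP 0)[l lN <-].
  by have := pair_b' (Ordinal lN) j; rewrite dj0 mul0r => ->.
pose s := [seq j <- enum 'I_N | dj j != 0].
have us : uniq s by rewrite filter_uniq ?enum_uniq.
pose B := [seq b' j | j <- s].
have span_c x : x \in <<[seq c k | k <- enum 'I_N]>>%VS.
  have : x \in <<enum_fset Rt>>%VS by rewrite (roots_span rs) memvf.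
  apply/subvP: x; apply/span_subvP => _ /(nthP 0)[l lN <-].
  have nl0 : nth 0 (enum_fset Rt) l != 0.
    by apply: contraNneq (roots_neq0 rs) => <-; apply: (rR (Ordinal lN)).
  have := neq0_dnorm_gt0 (s := ip) _ nl0; set y := nth _ _ _ => y0.
  have -> : y = (ip y y / 2) *: c (Ordinal lN).
    rewrite /c /coroot scalerA mulrA divfK ?pnatr_eq0// divff ?scale1r//.
    by rewrite gt_eqF.
  by rewrite rpredZ// memv_span// map_f// mem_enum.
have basisB : basis_of fullv B.
  apply/andP; split.
    rewrite eqEsubv subvf /=; apply/subvP => x _; move: (span_c x).
    apply/subvP: x; apply/span_subvP => _ /mapP[k _ ->].
    rewrite cE rpred_sum// => j _; rewrite -scaler_int rpredZ//.
    have [/b'0 ->|dj0] := eqVneq (dj j) 0; first exact: rpred0.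
    by rewrite memv_span// map_f// mem_filter dj0 mem_enum.
  pose X : (size s).-tuple E := [tuple of map b' (in_tuple s)].
  apply/(@freeP _ _ _ X) => k k0 i; pose si := tnth (in_tuple s).
  have XE (j : 'I_(size s)) : X`_j = b' (si j) by rewrite -tnth_nth tnth_map.
  pose v : 'rV[R]_N :=
    \row_j \sum_(i | si i == j) k i * (dj j)%:~R.
  have v0 : v *m map_mx intr U = 0.
    apply/rowP => l; rewrite !mxE.
    transitivity (ip (r l) (\sum_i k i *: X`_i)); last by rewrite k0 linear0r.
    rewrite linear_sumr /= (partition_big si xpredT) //=.
    apply: eq_bigr => j _; rewrite !mxE mulr_suml.
    by apply: eq_bigr => i' /eqP <-; rewrite XE linearZr_LR /= pair_b' rmorphM/= mulrA.
  have uU' : map_mx intr U \in @unitmx R N.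
    by rewrite unitmxE det_map_mx rmorph_unit// -unitmxE.
  have /rowP/(_ (si i)) : v = 0 by rewrite -[v](mulmxK uU') v0 mul0mx.
  have inj_si : injective si by apply/tuple_uniqP.
  rewrite !mxE (eq_bigl (pred1 i)); last by move=> j; rewrite /= (inj_eq inj_si).
  rewrite big_pred1_eq => /eqP; rewrite mulf_eq0 intr_eq0.
  have /(_ _ (mem_tnth i (in_tuple s))) : {in s, forall j, dj j != 0}.
    by move=> j; rewrite mem_filter => /andP[].
  by move=> /negPf -> /[!orbF] /eqP.
have sB : size B == \dim {:E}.
  by rewrite (size_basis (X := in_tuple B) basisB).
exists (Tuple sB); split=> // x.
pose G y := exists k : 'I_(\dim {:E}) -> int, y = \sum_i tnth (Tuple sB) i *~ k i.
have G0 : G 0 by exists (fun=> 0); rewrite big1.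
have GD y z : G y -> G z -> G (y + z).
  move=> [k ->] [k' ->]; exists (fun i => k i + k' i).
  by rewrite -big_split; apply: eq_bigr => i _; rewrite mulrzDr.
have GM y m : G y -> G (y *~ m).
  move=> [k ->]; exists (fun i => k i * m).
  by rewrite mulrz_suml; apply: eq_bigr => i _; rewrite mulrzA.
have Gb' j : G (b' j).
  have [/b'0 -> //|dj0] := eqVneq (dj j) 0.
  have /tnthP[i ->] : b' j \in Tuple sB.
    by rewrite map_f// mem_filter dj0 mem_enum.
  exists (fun l => (l == i)%:R); rewrite (bigD1 i)//= eqxx big1 ?addr0//.
  by move=> l /negPf ->.
have Gc k : G (c k) by rewrite cE; elim/big_ind: _ => // j _; exact: GM.
have rE (F : E -> E) : \sum_(alpha <- Rt) F alpha = \sum_k F (r k).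
  by rewrite (big_nth 0) big_mkord.
split=> [[k ->]|[k ->]].
  by rewrite rE; elim/big_ind: _ => // j _; apply: GM; exact: Gc.
pose H y := exists k : 'I_N -> int, y = \sum_i c i *~ k i.
have H0 : H 0 by exists (fun=> 0); rewrite big1.
have HD y z : H y -> H z -> H (y + z).
  move=> [f ->] [f' ->]; exists (fun i => f i + f' i).
  by rewrite -big_split; apply: eq_bigr => i _; rewrite mulrzDr.
have HM y m : H y -> H (y *~ m).
  move=> [f ->]; exists (fun i => f i * m).
  by rewrite mulrz_suml; apply: eq_bigr => i _; rewrite mulrzA.
have [f ->] : H (\sum_i tnth (Tuple sB) i *~ k i).
  elim/big_ind: _ => // i _; apply: HM.
  have /mapP[j _ ->] : tnth (Tuple sB) i \in B by exact: mem_tnth.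
  by exists (L' j).
exists (fun a => oapp f 0 (insub (index a (enum_fset Rt)))); rewrite rE.
apply: eq_bigr => i _; congr (_ *~ _).
by rewrite index_uniq// (insubT (fun x => x < N)%N (ltn_ord i)) /=; congr f; apply: val_inj.
Qed.

Lemma coroot_basisP : root_system ip Rt -> lattice_basis ip Rt (coroot_basis ip Rt).
Proof. by move=> /lattice_basis_exists; exact: xgetPex. Qed.

End CorootBasis.

Section TorusIntegral.
Context {R : realType}.

(* The Lebesgue integral over the unit cube of R^n, as an iterated integral. *)
Fixpoint cube_integral (n : nat) : (n.-tuple R -> R) -> R :=
  match n with
  | 0 => fun f => f [tuple]
  | n'.+1 => fun f =>
      \int[@lebesgue_measure R]_(t in `[0, 1])
        cube_integral (fun s : n'.-tuple R => f [tuple of t :: s])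
  end.

Context {E : vectType R}.
Variables (ip : {dot E for idfun}) (Rt : {fset E}).

Local Notation b := (coroot_basis ip Rt).

(* The parametrization t |-> 2 pi (t_1 b_1 + ... + t_n b_n) of the torus
   E / (2 pi Q^vee) by the unit cube, b being a Z-basis of Q^vee. *)
Definition torus_point (t : (\dim {:E}).-tuple R) : E :=
  \sum_i (2 * pi * tnth t i) *: tnth b i.

(* The Euclidean volume of the parallelotope spanned by the 2 pi b_i. *)
Definition torus_density : R :=
  Num.sqrt (\det (\matrix_(i, j)
    ip ((2 * pi) *: tnth b i) ((2 * pi) *: tnth b j))).

(* Integral of a (2 pi Q^vee)-periodic function on E over the torus. *)
Definition torus_integral (f : E -> R[i]) : R[i] :=
  torus_density%:C *
  (cube_integral (fun t => complex.Re (f (torus_point t))) +i*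
   cube_integral (fun t => complex.Im (f (torus_point t)))).

Definition torus_volume : R[i] := torus_integral (fun=> 1).

End TorusIntegral.

Section BernsteinSzego.
Context {R : realType} {E : vectType R}.
Variables (ip : {dot E for idfun}) (Rt Rp : {fset E}).
Variables (Ms Ml : nat) (ts : 'I_Ms -> R) (tl : 'I_Ml -> R).

Definition expi (theta : R) : R[i] := cos theta +i* sin theta.

Definition c_short (z : R[i]) : R[i] := \prod_(m < Ms) (1 + (ts m)%:C * z).
Definition c_long (z : R[i]) : R[i] := \prod_(m < Ml) (1 + (tl m)%:C * z).

Definition weyl_denominator (x : E) : R[i] :=
  \prod_(alpha <- Rp) (expi (ip alpha x / 2) - expi (- (ip alpha x / 2))).

Definition weight_C (x : E) : R[i] :=
  (\prod_(alpha <- pos_short ip Rt Rp) c_short (expi (- ip alpha x))) *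
  (\prod_(alpha <- pos_long ip Rt Rp) c_long (expi (- ip alpha x))).

Definition weight_Delta (x : E) : R[i] :=
  `|weyl_denominator x| ^+ 2 / (weight_C x * weight_C (- x)).

Definition inner_Delta (f g : E -> R[i]) : R[i] :=
  (#|` fset_set (weyl_group ip Rt)|%:R * torus_volume ip Rt)^-1 *
  torus_integral ip Rt (fun x => f x * (g x)^* * weight_Delta x).

Definition monomial_sym (lam x : E) : R[i] :=
  (#|` fset_set (stabilizer ip Rt lam)|%:R)^-1 *
  \sum_(w \in weyl_group ip Rt) expi (ip lam (w x)).

Definition bernstein_szego (lam : E) (p : E -> R[i]) : Prop :=
  (exists a : E -> R[i], a lam = 1 /\
     forall x, p x = \sum_(mu \in [set mu | dominant ip Rt Rp mu /\
                                           dominance_le Rp mu lam])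
                       a mu * monomial_sym mu x) /\
  forall mu, dominant ip Rt Rp mu -> dominance_lt Rp mu lam ->
    inner_Delta p (monomial_sym mu) = 0.

End BernsteinSzego.

(* Main.v *)
(* Let [lam] be sufficiently deep and let [g] be the antisymmetrization of
   [C(x) exp(i<lam + rho, x>)] over [W].  Depth puts all frequencies of [g] in the
   saturated set of [lam + rho], so [g = delta * f] with [f] in the span of the
   [m_mu], [mu <= lam].  In [<f, m_mu>] the weight cancels all of [g] but one
   exponential, leaving [int exp(i<lam + rho, x>) conj(delta m_mu) / C(-x)]; as
   [1 / C(-x)] is a power series in the [exp(i<alpha, x>)], [alpha] positive, this
   vanishes unless [lam <= mu], and it does not vanish for [mu = lam].  Comparing
   the defining orthogonality relations, [f = c p_lam] with [c <> 0] (in the sense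
   of the pairing), so that [<p_lam, m_mu> = 0] unless [lam <= mu]; hence
   [<p_lam, p_mu> = 0] unless [lam < mu], where it vanishes by the definition of
   [p_mu]. *)
Require Import Defs.
From HB Require Import structures.
From mathcomp Require Import all_boot all_order all_algebra finmap.
From mathcomp Require Import complex.
From mathcomp Require Import all_classical all_reals all_analysis.
From mathcomp Require Import ring lra zify.

Set Implicit Arguments.
Unset Strict Implicit.
Unset Printing Implicit Defensive.

Import Order.TTheory GRing.Theory Num.Theory numFieldNormedType.Exports.

Local Open Scope ring_scope.

(** * Integration over the unit cube *)

Section CubeIntegral.
Context {R : realType}.
Implicit Types n : nat.

(** The torus integral is an iterated one, so every integrand is kept in a class on which linearity
    can be proved by induction on the dimension. Inverses of [C] belong to it because [|1 + t z|] is
    at least [1 - |t|] on the unit circle. Integrating the power series of [1 / C(-x)] termwise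
    would require exchanging a limit with the integral; removing one geometric factor at a time
    gives a recursion between finitely normed means, which boundedness then solves. The definitions
    supply a regular vector [v] rather than simple roots: these are recovered as minimal generators
    of the cone of positive roots, and the pairing with [v] becomes a height that orders
    frequencies. The frequencies of [C] are not centred at 0, so [C] is recentred by the exponential
    of a half sum [rhoC], a weighted analogue of [rho]. The pairing is treated as a semidefinite
    form: a combination that is orthogonal to itself is shown, by Cauchy-Schwarz, to pair to zero
    with everything, and this is how [f] and [p_lam] are compared. *)

Definition dist1 n (t s : n.-tuple R) : R := \sum_i `|tnth t i - tnth s i|.

(* A class of integrands that is stable under the ring operations and under
   integrating out a coordinate of the cube. *)
Definition bounded_lipschitz n (f : n.-tuple R -> R) : Prop := exists K B : R,
  [/\ 0 <= K, forall t, `|f t| <= B & forall t s, `|f t - f s| <= K * dist1 t s].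

Lemma bl_bound_ge0 n (f : n.-tuple R -> R) B : (forall t, `|f t| <= B) -> 0 <= B.
Proof. by move=> /(_ [tuple of nseq n 0]); exact: le_trans. Qed.

Lemma bl_cst n c : bounded_lipschitz (fun _ : n.-tuple R => c).
Proof. by exists 0, `|c|; split=> // t s; rewrite subrr normr0 mul0r. Qed.

Lemma bl_add n (f g : n.-tuple R -> R) : bounded_lipschitz f -> bounded_lipschitz g ->
  bounded_lipschitz (fun t => f t + g t).
Proof.
move=> [K [M [K0 fM fK]]] [L [N [L0 gN gL]]]; exists (K + L), (M + N); split=> [|t|t s].
- exact: addr_ge0.
- by apply: le_trans (ler_normD _ _) _; exact: lerD.
- by rewrite opprD addrACA mulrDl; apply: le_trans (ler_normD _ _) _; exact: lerD.
Qed.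

Lemma bl_mul n (f g : n.-tuple R -> R) : bounded_lipschitz f -> bounded_lipschitz g ->
  bounded_lipschitz (fun t => f t * g t).
Proof.
move=> [K [M [K0 fM fK]]] [L [N [L0 gN gL]]].
have M0 := bl_bound_ge0 fM; have N0 := bl_bound_ge0 gN.
exists (M * L + K * N), (M * N); split=> [|t|t s].
- by rewrite addr_ge0// mulr_ge0.
- by rewrite normrM ler_pM.
- have -> : f t * g t - f s * g s = f t * (g t - g s) + (f t - f s) * g s by ring.
  apply: le_trans (ler_normD _ _) _; rewrite !normrM mulrDl -mulrA [K * N * _]mulrAC.
  by rewrite lerD// ler_pM.
Qed.

Lemma bl_opp n (f : n.-tuple R -> R) : bounded_lipschitz f -> bounded_lipschitz (fun t => - f t).
Proof.
move=> [K [M [K0 fM fK]]]; exists K, M; split=> // [t|t s]; first by rewrite normrN.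
by rewrite -opprD normrN.
Qed.

Lemma bl_inv n (f : n.-tuple R -> R) c : 0 < c -> (forall t, c <= f t) ->
  bounded_lipschitz f -> bounded_lipschitz (fun t => (f t)^-1).
Proof.
move=> c0 cf [K [M [K0 fM fK]]].
have f0 t : 0 < f t by exact: lt_le_trans (cf t).
have fV t : `|(f t)^-1| <= c^-1 by rewrite normfV gtr0_norm// lef_pV2// posrE.
exists (c^-1 * K * c^-1), c^-1; split=> [|//|t s].
  by rewrite !mulr_ge0// invr_ge0 ltW.
have -> : (f t)^-1 - (f s)^-1 = (f t)^-1 * (f s - f t) * (f s)^-1.
  by field; rewrite !gt_eqF.
rewrite !normrM (distrC (f s)).
have -> : c^-1 * K * c^-1 * dist1 t s = c^-1 * (K * dist1 t s) * c^-1 by ring.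
by rewrite !ler_pM ?mulr_ge0.
Qed.

Lemma dist1_cons n x y (t s : n.-tuple R) :
  dist1 [tuple of x :: t] [tuple of y :: s] = `|x - y| + dist1 t s.
Proof.
by rewrite /dist1 big_ord_recl !tnth0; congr (_ + _); apply: eq_bigr => i _; rewrite !tnthS.
Qed.

Lemma dist1_refl n (t : n.-tuple R) : dist1 t t = 0.
Proof. by rewrite /dist1 big1// => i _; rewrite subrr normr0. Qed.

Lemma bl_slice n (f : n.+1.-tuple R -> R) x : bounded_lipschitz f ->
  bounded_lipschitz (fun t : n.-tuple R => f [tuple of x :: t]).
Proof.
move=> [K [M [K0 fM fK]]]; exists K, M; split=> // t s.
by apply: le_trans (fK _ _) _; rewrite dist1_cons subrr normr0 add0r.
Qed.

Lemma lipschitz_integrable (f : R -> R) K : (forall x y, `|f x - f y| <= K * `|x - y|) ->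
  (@lebesgue_measure R).-integrable `[0, 1]%classic (EFin \o f).
Proof.
move=> fK; have K0 : 0 <= K by have := fK 0 1; rewrite sub0r normrN1 mulr1; exact: le_trans.
apply: continuous_compact_integrable; first exact: segment_compact.
apply: continuous_subspaceT => x; apply/cvgrPdist_lt => e e0.
apply/nbhs_ballP; exists (e / (K + 1)) => /=; first by rewrite divr_gt0// ltr_wpDl.
move=> y /= xy; apply: le_lt_trans (fK _ _) _.
have : `|x - y| * (K + 1) < e by rewrite -ltr_pdivlMr// ltr_wpDl.
by apply: le_lt_trans; rewrite mulrC ler_wpM2l// lerDl.
Qed.

Lemma cube_integral_ge0 n (f : n.-tuple R -> R) : (forall t, 0 <= f t) -> 0 <= cube_integral f.
Proof.
elim: n f => [|n IH] f f0 /=; first exact: f0.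
by apply: Rintegral_ge0 => x _; exact: IH.
Qed.

Lemma Rintegral_unit_cst (c : R) : \int[@lebesgue_measure R]_(x in `[0, 1]) c = c.
Proof.
by rewrite Rintegral_cst//= lebesgue_measure_itv /= lte_fin ltr01 oppr0 adde0 mulr1.
Qed.

(** Linearity and the bound need each other: the inner integral must be integrable in the outer
    variable, and it is Lipschitz there because the difference of two slices is, by linearity in
    dimension [n], the integral of a small function. *)
Lemma cube_integral_lin_bound n :
  (forall (f g : n.-tuple R -> R) a, bounded_lipschitz f -> bounded_lipschitz g ->
    cube_integral (fun t => a * f t + g t) = a * cube_integral f + cube_integral g) /\
  (forall (f : n.-tuple R -> R) B, bounded_lipschitz f -> (forall t, `|f t| <= B) ->
    `|cube_integral f| <= B).
Proof.
elim: n => [|n [IHl IHb]]; first by split=> [//|f B _]; exact.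
have slice f : bounded_lipschitz f -> exists K, forall x y,
    `|cube_integral (fun t : n.-tuple R => f [tuple of x :: t]) -
      cube_integral (fun t : n.-tuple R => f [tuple of y :: t])| <= K * `|x - y|.
  move=> blf; have [K [M [K0 fM fK]]] := blf; exists K => x y.
  have -> : forall a b : R, a - b = -1 * b + a by move=> a b; ring.
  rewrite -IHl; try exact: bl_slice.
  apply: IHb => [|t].
    by apply: bl_add; [apply: bl_mul; [exact: bl_cst|exact: bl_slice]|exact: bl_slice].
  by rewrite mulN1r addrC; apply: le_trans (fK _ _) _; rewrite dist1_cons dist1_refl addr0.
split=> [f g a blf blg|f M blf fM] /=.
  have [K fK] := slice f blf; have [L gL] := slice g blg.
  transitivity (\int[@lebesgue_measure R]_(x in `[0, 1])
    (a * cube_integral (fun t : n.-tuple R => f [tuple of x :: t]) +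
     cube_integral (fun t : n.-tuple R => g [tuple of x :: t]))).
    by apply: eq_Rintegral => x _; rewrite -IHl//; exact: bl_slice.
  rewrite RintegralD//; last 2 first.
  - apply: (@lipschitz_integrable _ (`|a| * K)) => x y.
    by rewrite -mulrBr normrM -mulrA ler_wpM2l.
  - exact: lipschitz_integrable gL.
  by rewrite RintegralZl//; exact: lipschitz_integrable fK.
have [K fK] := slice f blf.
apply: le_trans (le_normr_Rintegral _ _) _ => //; first exact: lipschitz_integrable fK.
rewrite -[leRHS]Rintegral_unit_cst; apply: le_Rintegral => //.
- apply: (@lipschitz_integrable _ K) => x y; apply: le_trans (fK x y).
  exact: ler_dist_dist.
- by apply: (@lipschitz_integrable _ 0) => x y; rewrite subrr normr0 mul0r.
- by move=> x _; apply: IHb => [|t]; [exact: bl_slice|exact: fM].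
Qed.

Lemma cube_integral_bound n (f : n.-tuple R -> R) M : bounded_lipschitz f ->
  (forall t, `|f t| <= M) -> `|cube_integral f| <= M.
Proof. by case: (cube_integral_lin_bound n) => _; apply. Qed.

Lemma cube_integralD n (f g : n.-tuple R -> R) : bounded_lipschitz f -> bounded_lipschitz g ->
  cube_integral (fun t => f t + g t) = cube_integral f + cube_integral g.
Proof.
move=> blf blg; case: (cube_integral_lin_bound n) => /(_ f g 1 blf blg) + _.
by rewrite mul1r => <-; congr cube_integral; apply/funext => t; rewrite mul1r.
Qed.

Lemma cube_integralZ n (f : n.-tuple R -> R) a : bounded_lipschitz f ->
  cube_integral (fun t => a * f t) = a * cube_integral f.
Proof.
move=> blf; case: (cube_integral_lin_bound n) => lin _.
have z : cube_integral (fun _ : n.-tuple R => 0) = 0.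
  apply/eqP; rewrite -normr_le0; apply: cube_integral_bound; first exact: bl_cst.
  by move=> t; rewrite normr0.
have := lin f (fun=> 0) a blf (bl_cst _ 0); rewrite z addr0 => <-.
by congr cube_integral; apply/funext => t; rewrite addr0.
Qed.

Lemma integral_cos (phi : R) (m : int) :
  \int[@lebesgue_measure R]_(x in `[0, 1]) cos (phi + 2 * pi * x * m%:~R) =
  if m == 0 then cos phi else 0.
Proof.
case: ifPn => [/eqP->|m0].
  by under eq_Rintegral do rewrite mulr0 addr0; rewrite Rintegral_unit_cst.
pose c : R := 2 * pi * m%:~R.
have c0 : c != 0 by rewrite !mulf_neq0 ?intr_eq0// gt_eqF// pi_gt0.
pose F (x : R) := sin (phi + c * x) / c.
have dF (x : R) : is_derive x (1 : R) F (cos (phi + c * x)).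
  by rewrite /F; apply: is_derive_eq; rewrite /GRing.scale /=; field.
have cF : continuous F.
  by move=> x; apply: differentiable_continuous; apply/derivable1_diffP; case: (dF x).
have ccos : continuous (fun x => cos (phi + c * x)).
  move=> x; apply: continuous_comp; last exact: continuous_cos.
  by apply: cvgD; [exact: cvg_cst|apply: cvgM; [exact: cvg_cst|exact: cvg_id]].
transitivity (F 1 - F 0).
  rewrite /Rintegral; under eq_integral => x _ do rewrite mulrAC -/c.
  rewrite (continuous_FTC2 (F := F)) ?ltr01//.
  - exact: continuous_subspaceT.
  - split=> [x _||]; first by case: (dF x).
      by apply: cvg_at_right_filter; exact: cF.
    by apply: cvg_at_left_filter; exact: cF.
  - by move=> x _; rewrite derive1E; case: (dF x).
rewrite /F -mulrBl mulr0 addr0 mulr1.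
suff -> : sin (phi + c) = sin phi by rewrite subrr mul0r.
have per (a : R) k : sin (a + 2 * pi * k%:R) = sin a.
  by rewrite mulr_natl mulr_natr (periodicn (@sinD2pi R)).
rewrite /c; case: (intP m) => [|k|k]; first by rewrite mulr0 addr0.
- exact: per.
- by rewrite -(per (phi + _) k.+1) mulrNz mulrN -addrA addNr addr0.
Qed.

(** The free phase [phi] drives the induction: it absorbs the outer coordinate while the inner ones
    are integrated. *)
Lemma cube_integral_cos n (phi : R) (m : 'I_n -> int) :
  cube_integral (fun t : n.-tuple R => cos (phi + \sum_i 2 * pi * tnth t i * (m i)%:~R)) =
  if [forall i, m i == 0] then cos phi else 0.
Proof.
elim: n phi m => [|n IH] phi m /=.
  by rewrite big_ord0 addr0; case: forallP => // -[] [].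
transitivity (\int[@lebesgue_measure R]_(x in `[0, 1])
  if [forall i, m (lift ord0 i) == 0] then cos (phi + 2 * pi * x * (m ord0)%:~R) else 0).
  apply: eq_Rintegral => x _; rewrite -IH; congr cube_integral; apply/funext => t.
  rewrite big_ord_recl tnth0 addrA; congr (cos (_ + _)); apply: eq_bigr => i _.
  by rewrite tnthS.
have -> : [forall i, m i == 0] = (m ord0 == 0) && [forall i, m (lift ord0 i) == 0].
  apply/forallP/andP => [h|[h0 /forallP h] i]; first by split=> //; apply/forallP.
  by case: (unliftP ord0 i) => [j|] ->.
case: [forall i, m (lift ord0 i) == 0]; first by rewrite integral_cos andbT.
by rewrite Rintegral_unit_cst andbF.
Qed.

Lemma cube_integral_sin n (phi : R) (m : 'I_n -> int) :
  cube_integral (fun t : n.-tuple R => sin (phi + \sum_i 2 * pi * tnth t i * (m i)%:~R)) =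
  if [forall i, m i == 0] then sin phi else 0.
Proof.
have sc (x : R) : sin x = cos (x - pi / 2) by rewrite cosB cos_pihalf sin_pihalf mulr0 mulr1 add0r.
rewrite [in RHS]sc -cube_integral_cos; congr cube_integral; apply/funext => t.
by rewrite sc addrAC.
Qed.

Lemma cos_lipschitz (x y : R) : `|cos x - cos y| <= `|x - y|.
Proof.
wlog xy : x y / x <= y.
  move=> h; have [/h//|/ltW/h] := leP x y.
  by rewrite distrC [leRHS]distrC.
have [|c _ e] := @MVT_segment R cos (fun z => - sin z) x y xy.
  by apply: continuous_subspaceT; exact: continuous_cos.
rewrite distrC e normrM normrN [leRHS]distrC ler_piMl//.
by rewrite ler_norml sin_geN1 sin_le1.
Qed.

Lemma bl_cos n (phi : R) (c : 'I_n -> R) :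
  bounded_lipschitz (fun t : n.-tuple R => cos (phi + \sum_i tnth t i * c i)).
Proof.
exists (\sum_i `|c i|), 1; split=> [|t|t s].
- by apply: sumr_ge0.
- by rewrite ler_norml cos_geN1 cos_le1.
apply: le_trans (cos_lipschitz _ _) _; rewrite opprD addrACA subrr add0r -sumrB.
apply: le_trans (ler_norm_sum _ _ _) _; rewrite /dist1 mulr_sumr; apply: ler_sum => i _.
rewrite -mulrBl normrM mulrC ler_wpM2r// (bigD1 i)//= lerDl.
by apply: sumr_ge0.
Qed.

Lemma bl_sin n (phi : R) (c : 'I_n -> R) :
  bounded_lipschitz (fun t : n.-tuple R => sin (phi + \sum_i tnth t i * c i)).
Proof.
have -> : (fun t : n.-tuple R => sin (phi + \sum_i tnth t i * c i)) =
    fun t => cos ((phi - pi / 2) + \sum_i tnth t i * c i).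
  apply/funext => t; rewrite [in RHS]addrAC cosB cos_pihalf sin_pihalf.
  by rewrite mulr0 mulr1 add0r.
exact: bl_cos.
Qed.

End CubeIntegral.

(** * Simple roots and the dominance order *)

Section RootSystem.
Context {R : realType} {E : vectType R}.
Variables (ip : {dot E for idfun}) (Rt Rp : {fset E}) (v : E).
Hypothesis rsys : root_system ip Rt.
Hypothesis v_regular : forall a, a \in Rt -> ip a v != 0.
Hypothesis RpE : Rp = [fset a in Rt | 0 < ip a v]%fset.

Local Notation refl := (reflection ip).
Local Notation cor := (coroot ip).
Local Notation W := (weyl ip Rt).

(** * Scalar product, reflections and the Weyl group *)

Lemma ipC x y : ip x y = ip y x.
Proof. by rewrite (hermC ip) /= expr0 mul1r. Qed.

Lemma ip_gt0 x : x != 0 -> 0 < ip x x.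
Proof. exact: neq0_dnorm_gt0. Qed.

Lemma ip_ge0 x : 0 <= ip x x.
Proof. by have [->|/ip_gt0/ltW//] := eqVneq x 0; rewrite linear0l. Qed.

Lemma ipZl c x y : ip (c *: x) y = c * ip x y.
Proof. exact: linearZl_LR. Qed.

Lemma ipZr c x y : ip x (c *: y) = c * ip x y.
Proof. by rewrite ipC ipZl ipC. Qed.

Lemma ipDl x y z : ip (x + y) z = ip x z + ip y z.
Proof. exact: linearDl. Qed.

Lemma ipBl x y z : ip (x - y) z = ip x z - ip y z.
Proof. exact: linearBl. Qed.

Lemma ipBr x y z : ip x (y - z) = ip x y - ip x z.
Proof. exact: linearBr. Qed.

Lemma ipNl x y : ip (- x) y = - ip x y.
Proof. exact: linearNl. Qed.

Lemma ipNr x y : ip x (- y) = - ip x y.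
Proof. exact: linearNr. Qed.

Lemma ipMnl x y n : ip (x *+ n) y = ip x y *+ n.
Proof. exact: linearMnl. Qed.

Lemma ip0l x : ip 0 x = 0. Proof. exact: linear0l. Qed.
Lemma ip0r x : ip x 0 = 0. Proof. exact: linear0r. Qed.

Lemma ip_suml (I : Type) (r : seq I) (P : pred I) (F : I -> E) y :
  ip (\sum_(i <- r | P i) F i) y = \sum_(i <- r | P i) ip (F i) y.
Proof. by rewrite -(applyrE ip y) linear_sum. Qed.

Lemma ip_sumr (I : Type) (r : seq I) (P : pred I) (F : I -> E) y :
  ip y (\sum_(i <- r | P i) F i) = \sum_(i <- r | P i) ip y (F i).
Proof. exact: linear_sumr. Qed.

(** [linfun] represents its argument only when that is linear, so the linear structure has to be
    exhibited. *)
Lemma reflE a x : refl a x = x - ip x (cor a) *: a.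
Proof.
pose f (x : E) := x - ip x (cor a) *: a.
have lf : linear f.
  by move=> c y z; rewrite /f ipDl ipZl scalerDl opprD addrACA scalerBr scalerA.
pose F : {linear E -> E} := HB.pack f (GRing.isLinear.Build R E E _ f lf).
exact: (lfunE F x).
Qed.

Lemma root_neq0 a : a \in Rt -> a != 0.
Proof. by move=> aR; apply: contraNneq (roots_neq0 rsys) => <-. Qed.

Lemma root_norm_gt0 a : a \in Rt -> 0 < ip a a.
Proof. by move=> /root_neq0/ip_gt0. Qed.

Lemma ip_coroot x a : ip x (cor a) = 2 / ip a a * ip x a.
Proof. by rewrite ipZr. Qed.

Lemma ip_coroot_self a : a \in Rt -> ip a (cor a) = 2.
Proof. by move=> /root_norm_gt0 a0; rewrite ip_coroot divfK// gt_eqF. Qed.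

Lemma refl_self a : a \in Rt -> refl a a = - a.
Proof. by move=> aR; rewrite reflE ip_coroot_self// scaler_nat mulr2n opprD addrA subrr add0r. Qed.

Lemma ip_refl a x y : ip (refl a x) y = ip x (refl a y).
Proof.
rewrite !reflE ipBl ipBr !ip_coroot ipZl ipZr (ipC a y).
by congr (_ - _); ring.
Qed.

Lemma reflK a x : a \in Rt -> refl a (refl a x) = x.
Proof.
move=> aR; rewrite [refl a x]reflE linearB linearZ /= refl_self// reflE.
by rewrite scalerN opprK subrK.
Qed.

Lemma refl_isom a x y : a \in Rt -> ip (refl a x) (refl a y) = ip x y.
Proof. by move=> aR; rewrite ip_refl reflK. Qed.

Lemma root_opp a : a \in Rt -> - a \in Rt.
Proof. by move=> aR; rewrite -refl_self//; apply: (roots_refl rsys). Qed.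

Lemma refl_opp a x : refl (- a) x = refl a x.
Proof. by rewrite !reflE !ip_coroot !ipNr ipNl opprK scalerN mulrN scaleNr opprK. Qed.

Lemma weyl_mul w1 w2 : W w1 -> W w2 -> W (w1 \o w2)%VF.
Proof.
elim=> [|a w aR _ IH] W2; first by rewrite comp_lfun1l.
by rewrite -comp_lfunA; apply: weyl_refl => //; exact: IH.
Qed.

Lemma weyl_reflection a : a \in Rt -> W (refl a).
Proof. by move=> aR; rewrite -[refl a]comp_lfun1r; apply: weyl_refl => //; exact: weyl_id. Qed.

Lemma weyl_isom w x y : W w -> ip (w x) (w y) = ip x y.
Proof.
elim=> [|a u aR _ IH]; first by rewrite !id_lfunE.
by rewrite !comp_lfunE refl_isom.
Qed.

Lemma weyl_root w a : W w -> a \in Rt -> w a \in Rt.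
Proof.
elim=> [|b u bR _ IH] aR; first by rewrite id_lfunE.
by rewrite comp_lfunE; apply: (roots_refl rsys) => //; exact: IH.
Qed.

Lemma weyl_has_inv w : W w -> exists u, [/\ W u, (u \o w = \1)%VF & (w \o u = \1)%VF].
Proof.
elim=> [|a w' aR _ [u [Wu uw wu]]].
  by exists \1%VF; split; rewrite ?comp_lfun1l//; exact: weyl_id.
have ss : (refl a \o refl a = \1)%VF.
  by apply/lfunP => x; rewrite comp_lfunE id_lfunE reflK.
exists (u \o refl a)%VF; split.
- exact: weyl_mul (weyl_reflection aR).
- by rewrite -comp_lfunA (comp_lfunA (refl a)) ss comp_lfun1l.
- by rewrite -comp_lfunA (comp_lfunA w') wu comp_lfun1l.
Qed.

(** The inverse of an endomorphism is a total operation; a left inverse [u] makes the kernel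
    trivial, where it is a genuine inverse. *)
Lemma weyl_inv_eq (w u : 'End(E)) : (u \o w = \1)%VF -> (w^-1)%VF = u.
Proof.
move=> uw; have wu x : u (w x) = x by rewrite -comp_lfunE uw id_lfunE.
have k0 : lker w == 0%VS by apply/lker0P; exact: can_inj wu.
apply/lfunP => x; rewrite -{2}[x](lker0_lfunVK k0) wu //.
Qed.

Lemma weyl_inv w : W w -> W (w^-1)%VF.
Proof. by case/weyl_has_inv => u [Wu /weyl_inv_eq-> _]. Qed.

Lemma weylK w x : W w -> (w^-1)%VF (w x) = x.
Proof.
by case/weyl_has_inv => u [_ uw _]; rewrite (weyl_inv_eq uw) -comp_lfunE uw id_lfunE.
Qed.

Lemma weylVK w x : W w -> w ((w^-1)%VF x) = x.
Proof.
by case/weyl_has_inv => u [_ uw wu]; rewrite (weyl_inv_eq uw) -comp_lfunE wu id_lfunE.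
Qed.

Lemma refl_inv a : a \in Rt -> ((refl a)^-1)%VF = refl a.
Proof.
by move=> aR; apply: weyl_inv_eq; apply/lfunP => x; rewrite comp_lfunE id_lfunE reflK.
Qed.

Lemma weyl_inv_comp w u : W w -> W u -> ((w \o u)^-1)%VF = (u^-1 \o w^-1)%VF.
Proof.
move=> Ww Wu; apply: weyl_inv_eq; apply/lfunP => x.
by rewrite !comp_lfunE id_lfunE !weylK.
Qed.

Lemma ip_weyl w x y : W w -> ip x (w y) = ip ((w^-1)%VF x) y.
Proof. by move=> Ww; rewrite -{1}[x](weylVK x Ww) weyl_isom. Qed.

Lemma weyl_coroot w a x : W w -> ip (w x) (cor (w a)) = ip x (cor a).
Proof. by move=> Ww; rewrite !ip_coroot !weyl_isom. Qed.

Lemma refl_conj w a x : W w -> refl (w a) (w x) = w (refl a x).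
Proof. by move=> Ww; rewrite !reflE weyl_coroot// [RHS]linearB [in RHS]linearZ. Qed.

Lemma pos_root a : a \in Rp = (a \in Rt) && (0 < ip a v).
Proof. by rewrite RpE !inE. Qed.

Lemma posR a : a \in Rp -> a \in Rt. Proof. by rewrite pos_root => /andP[]. Qed.
(** The vector [v] that selects the positive roots serves as a height from here on. *)
Lemma pos_ht a : a \in Rp -> 0 < ip a v. Proof. by rewrite pos_root => /andP[]. Qed.

Lemma root_posVneg a : a \in Rt -> (a \in Rp) || (- a \in Rp).
Proof.
move=> aR; rewrite !pos_root aR root_opp//= ipNl oppr_gt0.
by have := v_regular aR; rewrite neq_lt orbC.
Qed.

Lemma root_neg a : a \in Rt -> (- a \in Rp) = (a \notin Rp).
Proof.
move=> aR; rewrite !pos_root aR root_opp//= ipNl oppr_gt0 -leNgt.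
by rewrite [RHS]le_eqVlt (negPf (v_regular aR)).
Qed.

(** * Simple roots *)

Definition in_cone (B : {fset E}) x :=
  exists2 d : E -> R, (forall b, 0 <= d b) & x = \sum_(b <- B) d b *: b.

Definition generating B := forall a, a \in Rp -> in_cone B a.

(* The simple roots, as a minimal set generating the real cone of positive roots. *)
Definition base B := [/\ {subset B <= Rp}, generating B &
  forall b, b \in B -> ~ generating (B `\ b)%fset].

Lemma base_exists : exists B, base B.
Proof.
have gRp : generating Rp.
  move=> a aR; exists (fun b => (b == a)%:R) => [b|]; first by rewrite ler0n.
  rewrite (big_rem a) //= eqxx scale1r big1_seq ?addr0// => b /andP[_ bR].
  have -> : (b == a) = false; last by rewrite scale0r.
  by apply/negP => /eqP ba; move: bR; rewrite ba mem_rem_uniq ?fset_uniq// inE eqxx.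
suff H n B : generating B -> {subset B <= Rp} -> (#|` B| < n)%N -> exists B', base B'.
  by exact: (H _ Rp gRp _ (leqnn _)).
elim: n B => // n IH B gB sB Bn.
have [[b [bB gb]]|nb] := pselect (exists b, b \in B /\ generating (B `\ b)%fset).
  apply: (IH (B `\ b)%fset gb).
    by move=> x /fsetD1P[_ /sB].
  by rewrite (cardfsD1 b) bB add1n ltnS in Bn.
by exists B; split=> // b bB gb; apply: nb; exists b.
Qed.

Variable B : {fset E}.
Hypothesis baseB : base B.

Let subB b : b \in B -> b \in Rp. Proof. by case: baseB => sB _ _; exact: sB. Qed.
Let subBR b : b \in B -> b \in Rt. Proof. by move=> /subB/posR. Qed.

Lemma big_fsetD1E (V : nmodType) (A : {fset E}) b (F : E -> V) : b \in A ->
  \sum_(x <- A) F x = F b + \sum_(x <- (A `\ b)%fset) F x.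
Proof. by move=> bA; rewrite (big_fsetD1 b). Qed.

(** Simple roots span extreme rays. If [c > d b], the equation expresses [b] through the other
    generators, against minimality; otherwise pairing it with [v] makes a sum of nonnegative terms
    nonpositive, and each term vanishes. *)
Lemma base_ray b c d : b \in B -> (forall x, 0 <= d x) ->
  c *: b = \sum_(x <- B) d x *: x -> forall x, x \in B -> x != b -> d x = 0.
Proof.
move=> bB d0; rewrite (big_fsetD1E _ bB) => /eqP.
rewrite addrC -subr_eq -scalerBl => /eqP eb x xB xb.
case: (ltP 0 (c - d b)) => [cd|cd].
  case: baseB => _ gB /(_ b bB) [] a /gB[e e0 ->].
  exists (fun x => e b * d x / (c - d b) + e x) => [y|].
    by rewrite addr_ge0// divr_ge0 ?mulr_ge0// ltW.
  under [RHS]eq_bigr do rewrite scalerDl.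
  rewrite big_split /= (big_fsetD1E _ bB); congr (_ + _).
  under [RHS]eq_bigr do rewrite mulrAC -scalerA.
  by rewrite -scaler_sumr -eb scalerA divfK// gt_eqF.
have xB' : x \in (B `\ b)%fset by rewrite !inE xb.
have nn y : y \in (B `\ b)%fset -> 0 <= d y * ip y v.
  by move=> /fsetD1P[_ /subB/pos_ht/ltW]; exact: mulr_ge0.
have s0 : \sum_(y <- (B `\ b)%fset) d y * ip y v <= 0.
  rewrite -(_ : (c - d b) * ip b v = \sum_(y <- (B `\ b)%fset) d y * ip y v).
    by rewrite mulr_le0_ge0// ltW// pos_ht// subB.
  transitivity (ip ((c - d b) *: b) v); first by rewrite ipZl.
  rewrite eb ip_suml; apply: eq_bigr => y _.
  by rewrite /= ipZl.
have : d x * ip x v <= 0.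
  apply: le_trans s0; rewrite (big_fsetD1E _ xB') lerDl big_seq sumr_ge0//.
  by move=> y /fsetD1P[_ /nn].
rewrite pmulr_lle0 ?pos_ht ?subB// => dx; apply/eqP.
by rewrite eq_le dx d0.
Qed.

(* If [g = - refl b a] were positive, then [a + g] would be a multiple of [b], so
   [base_ray] would make [a] itself a multiple of [b]. *)
Lemma simple_perm b a : b \in B -> a \in Rp -> a != b -> refl b a \in Rp.
Proof.
move=> bB aP ab; have aR := posR aP; have bR := subBR bB.
have sR : refl b a \in Rt by exact: (roots_refl rsys).
apply/negPn/negP; rewrite -root_neg// => gP.
case: baseB => _ gB _; have [d d0 ae] := gB _ aP; have [e e0 ge] := gB _ gP.
have de0 x : 0 <= d x + e x by rewrite addr_ge0.
have ke : ip a (cor b) *: b = \sum_(x <- B) (d x + e x) *: x.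
  under eq_bigr do rewrite scalerDl.
  by rewrite big_split /= -ae -ge reflE opprB addrC subrK.
have dz x : x \in B -> x != b -> d x = 0.
  move=> xB xb; have /eqP := base_ray bB de0 ke xB xb.
  by rewrite paddr_eq0// => /andP[/eqP].
have abE : a = d b *: b.
  rewrite {1}ae (big_fsetD1E _ bB) big1_seq ?addr0// => x /andP[_ /fsetD1P[xb xB]].
  by rewrite dz// scale0r.
have [d1|d1] : d b = 1 \/ d b = -1.
  by apply: (roots_reduced rsys bR); rewrite -abE.
- by move: ab; rewrite abE d1 scale1r eqxx.
- by have := pos_ht aP; rewrite abE d1 scaleN1r ipNl oppr_gt0 ltNge ltW// pos_ht// subB.
Qed.

Lemma cone_nonneg x y : in_cone B x -> (forall b, b \in B -> 0 <= ip y b) -> 0 <= ip y x.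
Proof.
move=> [d d0 ->] yB; rewrite ip_sumr big_seq sumr_ge0// => b bB.
by rewrite ipZr mulr_ge0// yB.
Qed.

(** Otherwise [- a] would pair nonnegatively with [B], hence with its cone, which contains [a]. *)
Lemma pos_pairing a : a \in Rp -> exists2 b, b \in B & 0 < ip a b.
Proof.
move=> aP; apply: contrapT => nb.
have : 0 <= ip (- a) a.
  apply: cone_nonneg; first by case: baseB => _ gB _; exact: gB.
  move=> b bB; rewrite ipNl oppr_ge0 leNgt; apply/negP => ?.
  by apply: nb; exists b.
by rewrite ipNl oppr_ge0 leNgt root_norm_gt0// posR.
Qed.

(** * Words in simple reflections *)

Fixpoint word (s : seq E) : 'End(E) :=
  if s is b :: s' then (refl b \o word s')%VF else \1%VF.

Lemma word_cat s t : word (s ++ t) = (word s \o word t)%VF.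
Proof. by elim: s => [|b s IH] /=; rewrite ?comp_lfun1l// IH comp_lfunA. Qed.

Lemma word_weyl s : {subset s <= B} -> W (word s).
Proof.
elim: s => [|b s IH] sB /=; first exact: weyl_id.
apply: weyl_refl; first by apply: subBR; apply: sB; rewrite inE eqxx.
by apply: IH => x xs; apply: sB; rewrite inE xs orbT.
Qed.

(** Induction on the number of positive roots of smaller height: a simple [b] with [ip a b > 0]
    reflects [a] to a positive root of smaller height. *)
Lemma pos_word a : a \in Rp -> exists s b, [/\ {subset s <= B}, b \in B & a = word s b].
Proof.
have [n] := ubnP #|` [fset x in Rp | (ip x v < ip a v)%R]|%fset.
elim: n a => // n IH a an aP.
have [aB|aB] := boolP (a \in B); first by exists [::], a; rewrite id_lfunE.
have [b bB ab] := pos_pairing aP.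
have ab' : a != b by apply: contraNneq aB => ->.
have sP := simple_perm bB aP ab'.
have bb0 : 0 < ip b b by exact/root_norm_gt0/subBR.
have hts : ip (refl b a) v < ip a v.
  rewrite reflE ipBl ipZl /= ltrBlDr ltrDl ip_coroot.
  by rewrite !mulr_gt0 ?invr_gt0// pos_ht ?subB.
have [||s [b' [sB b'B e]]] := IH (refl b a) => //.
  rewrite -ltnS; apply: leq_trans an; rewrite ltnS.
  apply: fproper_ltn_card; rewrite fproperE; apply/andP; split.
    apply/fsubsetP.
    by move=> x; rewrite !inE /= => /andP[-> /lt_trans]; apply.
  by apply/fsubsetPn; exists (refl b a); rewrite !inE /= ?sP ?hts ?ltxx ?andbF.
exists (b :: s), b'; split=> //.
  by move=> x; rewrite inE => /predU1P[->|/sB].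
by rewrite /= comp_lfunE -e reflK// subBR.
Qed.

Lemma word_rev s : {subset s <= B} -> (word s \o word (rev s) = \1)%VF.
Proof.
elim: s => [|b s IH] sB /=; first by rewrite comp_lfun1l.
have bR : b \in Rt by apply: subBR; apply: sB; rewrite inE eqxx.
rewrite rev_cons -cats1 word_cat /= comp_lfun1r -comp_lfunA (comp_lfunA (word s)).
rewrite IH; last by move=> x xs; apply: sB; rewrite inE xs orbT.
by rewrite comp_lfun1l; apply/lfunP => x; rewrite comp_lfunE id_lfunE reflK.
Qed.

(** Up to sign a root is [word s b] with [b] simple, so its reflection is the conjugate spelled by
    [s], [b], [rev s]. *)
Lemma weyl_word w : W w -> exists2 s, {subset s <= B} & w = word s.
Proof.
elim=> [|a u aR _ [t tB ->]]; first by exists [::].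
have [a' a'P ->] : exists2 a', a' \in Rp & refl a = refl a'.
  case/orP: (root_posVneg aR) => aP; first by exists a.
  by exists (- a) => //; apply/lfunP => x; rewrite refl_opp.
have [s [b [sB bB ->]]] := pos_word a'P.
exists (s ++ (b :: rev s) ++ t).
  move=> x; rewrite !(mem_cat, inE, mem_rev).
  by do !case/orP; [exact: sB|move/eqP->|exact: sB|exact: tB].
rewrite !word_cat /=; apply/lfunP => x; rewrite !comp_lfunE.
set y := word t x; rewrite -refl_conj; last exact: word_weyl.
by rewrite -(comp_lfunE (word s)) word_rev// id_lfunE.
Qed.

(** The exchange condition. Applying the letters of [s] to [b] one after the other, the root turns
    negative at some letter; by [simple_perm] it then equals that letter, whose reflection cancels
    the one of [b]. *)
Lemma word_exchange s b : {subset s <= B} -> b \in B -> word s b \notin Rp ->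
  exists t, [/\ {subset t <= B}, (size t < size s)%N &
    forall x, word s (refl b x) = word t x].
Proof.
elim: s => [|c s IH] sB bB /=; first by rewrite id_lfunE subB.
have cB : c \in B by apply: sB; rewrite inE eqxx.
have sB' : {subset s <= B} by move=> x xs; apply: sB; rewrite inE xs orbT.
rewrite comp_lfunE; have [sbP|sbN _] := boolP (word s b \in Rp); last first.
  have [t [tB ts te]] := IH sB' bB sbN; exists (c :: t); split=> //.
    by move=> x; rewrite inE => /predU1P[->|/tB].
  by move=> x /=; rewrite !comp_lfunE te.
have [sbc|sbc] := eqVneq (word s b) c; last by rewrite simple_perm.
move=> _; exists s; split=> // x; rewrite comp_lfunE -refl_conj ?sbc ?reflK ?subBR//.
exact: word_weyl.
Qed.

(** * The dominance order on Weyl orbits *)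

Lemma root_cone0 : root_cone Rp 0.
Proof. by exists (fun=> 0%N); rewrite big1. Qed.

Lemma root_coneD x y : root_cone Rp x -> root_cone Rp y -> root_cone Rp (x + y).
Proof.
move=> [k ->] [l ->]; exists (fun a => k a + l a)%N.
by rewrite -big_split; apply: eq_bigr => a _; rewrite mulrnDr.
Qed.

Lemma root_coneMn x n : root_cone Rp x -> root_cone Rp (x *+ n).
Proof.
move=> cx; elim: n => [|n IH]; first exact: root_cone0.
by rewrite mulrS; exact: root_coneD.
Qed.

Lemma root_cone_pos a : a \in Rp -> root_cone Rp a.
Proof.
move=> aP; exists (fun b => (b == a) : nat); rewrite (big_fsetD1E _ aP) eqxx mulr1n.
by rewrite big1_seq ?addr0// => b /andP[_ /fsetD1P[/negPf-> _]].
Qed.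

Lemma root_cone_ht x : root_cone Rp x -> 0 <= ip x v.
Proof.
move=> [k ->]; rewrite ip_suml big_seq sumr_ge0// => a aP /=.
by rewrite ipMnl mulrn_wge0// ltW// pos_ht.
Qed.

Lemma root_cone_ht0 x : root_cone Rp x -> ip x v <= 0 -> x = 0.
Proof.
move=> [k ->] h; rewrite big_seq big1// => a aP.
have : ip (a *+ k a) v <= 0.
  apply: le_trans h; rewrite (big_fsetD1E _ aP) ipDl lerDl.
  by apply: root_cone_ht; exists (fun b => if b \in (Rp `\ a)%fset then k b else 0%N);
    rewrite [RHS](big_fsetD1E _ aP) !inE eqxx mulr0n add0r big_seq [RHS]big_seq;
    apply: eq_bigr => b ->.
rewrite ipMnl; case: (k a) => [|n]; first by rewrite mulr0n.
by rewrite leNgt pmulrn_lgt0// pos_ht.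

Qed.

(** Induction on the length, splitting off the last letter [b]. If [word s b] is positive, [b]
    contributes a natural multiple of it to the difference; if not, the exchange condition yields a
    shorter word. *)
Lemma dominance_word x s : (forall b, b \in B -> ip x (cor b) \is a Num.nat) ->
  {subset s <= B} -> root_cone Rp (x - word s x).
Proof.
move=> xB; have [n] := ubnP (size s); elim: n s => // n IH s sn sB.
case/lastP: s => [|s b] in sn sB *; first by rewrite id_lfunE subrr; exact: root_cone0.
have bB : b \in B by apply: sB; rewrite mem_rcons inE eqxx.
have sB' : {subset s <= B} by move=> y ys; apply: sB; rewrite mem_rcons inE ys orbT.
rewrite size_rcons ltnS in sn; rewrite -cats1 word_cat /= comp_lfun1r comp_lfunE.
have [sP|sN] := boolP (word s b \in Rp); last first.
  have [t [tB ts ->]] := word_exchange sB' bB sN; apply: IH => //.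
  exact: ltn_trans sn.
have /natrP[k ke] := xB _ bB.
rewrite reflE ke scaler_nat linearB linearMn /= opprB addrCA.
by apply: root_coneD; [exact/root_coneMn/root_cone_pos|exact: IH].
Qed.

Lemma dominance_weyl x w : (forall b, b \in B -> ip x (cor b) \is a Num.nat) ->
  W w -> root_cone Rp (x - w x).
Proof. by move=> xB /weyl_word[s sB ->]; exact: dominance_word. Qed.

(** * The action of [W] on positive roots up to sign, and the sign character *)

Definition rabs a : E := if a \in Rp then a else - a.

Lemma rabs_cases a : rabs a = a \/ rabs a = - a.
Proof. by rewrite /rabs; case: ifP; [left|right]. Qed.

Lemma rabs_pos a : a \in Rt -> rabs a \in Rp.
Proof.
move=> aR; rewrite /rabs; case: ifP => // /negbT aN.
by rewrite root_neg.
Qed.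

Lemma rabs_inj w a b : W w -> a \in Rp -> b \in Rp -> rabs (w a) = rabs (w b) -> a = b.
Proof.
move=> Ww aP bP.
have wi : injective w by apply: (can_inj (g := (w^-1)%VF)) => x; apply: weylK.
have nab : a <> - b.
  move=> ab; have := pos_ht aP; rewrite ab ipNl oppr_gt0 ltNge.
  by rewrite ltW// pos_ht.
have nab' : - a <> b by move=> ab; apply: nab; rewrite -ab opprK.
case: (rabs_cases (w a)) (rabs_cases (w b)) => -> [] ->.
- exact: wi.
- by rewrite -linearN => /wi/nab.
- by rewrite -linearN => /wi/nab'.
- by move=> /oppr_inj/wi.
Qed.

(** No positive root is the opposite of another, so forgetting signs keeps [w] injective on [Rp]; on
    a stable finite set it is then a permutation. *)
Lemma perm_rabs (A : {fset E}) w : W w -> {subset A <= Rp} ->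
  (forall a, a \in A -> rabs (w a) \in A) -> perm_eq [seq rabs (w a) | a <- A] A.
Proof.
move=> Ww sA cA.
have u : uniq [seq rabs (w a) | a <- A].
  rewrite map_inj_in_uniq ?fset_uniq// => a b /sA aP /sA bP; exact: rabs_inj.
apply: uniq_perm => //; first exact: fset_uniq.
apply: (uniq_min_size u _ _).2; last by rewrite size_map.
by move=> _ /mapP[a aA ->]; apply: cA.
Qed.

Lemma big_weyl_even (T : Type) (idx : T) (op : Monoid.com_law idx) (A : {fset E}) w (F : E -> T) :
  W w -> {subset A <= Rp} -> (forall a, a \in A -> rabs (w a) \in A) ->
  (forall a, F (- a) = F a) ->
  \big[op/idx]_(a <- A) F (w a) = \big[op/idx]_(a <- A) F a.
Proof.
move=> Ww sA cA Fe; rewrite -[RHS](perm_big _ (perm_rabs Ww sA cA)) big_map.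
by apply: eq_bigr => a _; case: (rabs_cases (w a)) => ->; rewrite ?Fe.
Qed.

Lemma rabs_stable w a : W w -> a \in Rp -> rabs (w a) \in Rp.
Proof. by move=> Ww aP; apply: rabs_pos; apply: weyl_root => //; exact: posR. Qed.

Lemma short_root_rabs w a : W w -> a \in Rp ->
  short_root ip Rt (rabs (w a)) = short_root ip Rt a.
Proof.
move=> Ww aP; have waR : w a \in Rt by apply: weyl_root => //; exact: posR.
have e : ip (rabs (w a)) (rabs (w a)) = ip a a.
  by case: (rabs_cases (w a)) => ->; rewrite ?ipNl ?ipNr ?opprK weyl_isom.
by rewrite /short_root e (posR (rabs_stable Ww aP)) (posR aP).
Qed.

Lemma pos_short_sub : {subset pos_short ip Rt Rp <= Rp}.
Proof. by move=> a; rewrite !inE => /andP[]. Qed.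

Lemma pos_long_sub : {subset pos_long ip Rt Rp <= Rp}.
Proof. by move=> a; rewrite !inE => /andP[]. Qed.

Lemma pos_short_rabs w a : W w -> a \in pos_short ip Rt Rp -> rabs (w a) \in pos_short ip Rt Rp.
Proof.
by move=> Ww; rewrite !inE /= => /andP[aP sa]; rewrite rabs_stable// short_root_rabs.
Qed.

Lemma pos_long_rabs w a : W w -> a \in pos_long ip Rt Rp -> rabs (w a) \in pos_long ip Rt Rp.
Proof.
move=> Ww; rewrite !inE /= /long_root => /and3P[aP _ sa].
by rewrite rabs_stable// short_root_rabs// posR ?rabs_stable.
Qed.

Definition rsgn a : R[i] := if a \in Rp then 1 else -1.

(** The sign character of [W]: the parity of the number of positive roots made negative by [w]. *)
Definition eps (w : 'End(E)) : R[i] := \prod_(a <- Rp) rsgn (w a).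

Lemma rsgnN a : a \in Rt -> rsgn (- a) = - rsgn a.
Proof.
move=> aR; rewrite /rsgn root_neg//.
by case: (a \in Rp) => //=; rewrite opprK.
Qed.

Lemma rsgn_weyl w a : W w -> a \in Rt -> rsgn (w a) = rsgn a * rsgn (w (rabs a)).
Proof.
move=> Ww aR; rewrite {2}/rsgn /rabs; case: ifP => _; first by rewrite mul1r.
by rewrite linearN mulN1r rsgnN ?opprK//; exact: weyl_root.
Qed.

Lemma eps_mul u w : W u -> W w -> eps (u \o w)%VF = eps u * eps w.
Proof.
move=> Wu Ww; rewrite /eps.
rewrite -[X in X * _](perm_big _ (perm_rabs Ww (fun _ h => h) (fun a => rabs_stable Ww))).
rewrite big_map -big_split /= big_seq [RHS]big_seq; apply: eq_bigr => a aP.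
have waR : w a \in Rt by apply: weyl_root => //; exact: posR.
by rewrite comp_lfunE (rsgn_weyl Wu waR) mulrC.
Qed.

Lemma eps_sqr w : eps w * eps w = 1.
Proof.
rewrite /eps -big_split big1// => a _ /=; rewrite /rsgn.
by case: ifP => _; rewrite ?mulrNN mulr1.
Qed.

Lemma eps_conj w : (eps w)^* = eps w.
Proof.
rewrite /eps; elim/big_rec: _ => [|a z _ IH]; first by rewrite rmorph1.
by rewrite rmorphM /= IH /rsgn; case: ifP; rewrite ?rmorphN rmorph1.
Qed.

Lemma eps_simple b : b \in B -> eps (refl b) = -1.
Proof.
move=> bB; rewrite /eps (big_fsetD1 b) ?subB//= refl_self ?subBR//.
rewrite rsgnN ?subBR// /rsgn subB// big_seq big1 ?mulr1// => a /fsetD1P[ab aP].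
by rewrite simple_perm.
Qed.

(** * Weighted half sums of positive roots, and weights *)

Definition halfsum f : E := \sum_(a <- Rp) (f a / 2) *: a.

(** The reflection in [b] permutes the positive roots other than [b], preserves [f] on them and
    reverses the pairing with the coroot of [b], so their total contribution equals its opposite. It
    serves both [rho] and [rhoC]. *)
Lemma halfsum_simple (f : E -> R) b : b \in B ->
  (forall a, a \in Rp -> a != b -> f (refl b a) = f a) ->
  ip (halfsum f) (cor b) = f b.
Proof.
move=> bB fb; pose A := (Rp `\ b)%fset; have bR := subBR bB.
rewrite /halfsum (big_fsetD1 b) ?subB//= ipDl ipZl ip_coroot_self// divfK//.
set S := ip _ _; suff : S = - S.
  by move/eqP; rewrite -addr_eq0 -mulr2n mulrn_eq0 /= => /eqP->; rewrite addr0.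
rewrite /S ip_suml.
have p : perm_eq [seq refl b a | a <- A] A.
  have u : uniq [seq refl b a | a <- A].
    rewrite map_inj_in_uniq ?fset_uniq// => x y _ _ e.
    by rewrite -(reflK x bR) e reflK.
  apply: uniq_perm => //; first exact: fset_uniq.
  apply: (uniq_min_size u _ _).2; last by rewrite size_map.
  move=> _ /mapP[a /fsetD1P[ab aP] ->]; rewrite in_fsetD1.
  rewrite simple_perm// andbT.
  apply: contraTneq aP => e; rewrite -(reflK a bR) e refl_self//.
  by rewrite root_neg// subB.
rewrite -[LHS](perm_big _ p) big_map -sumrN big_seq [RHS]big_seq.
apply: eq_bigr => a /fsetD1P[ab aP]; rewrite !ipZl fb// -mulrN; congr (_ * _).
by rewrite ip_coroot ip_refl refl_self// ipNr mulrN -ip_coroot.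
Qed.

Lemma weightD x y : weight ip Rt x -> weight ip Rt y -> weight ip Rt (x + y).
Proof. by move=> hx hy a aR; rewrite ipDl rpredD ?hx ?hy. Qed.

Lemma weightN x : weight ip Rt x -> weight ip Rt (- x).
Proof. by move=> hx a aR; rewrite ipNl rpredN hx. Qed.

Lemma weightB x y : weight ip Rt x -> weight ip Rt y -> weight ip Rt (x - y).
Proof. by move=> hx hy; apply: weightD => //; exact: weightN. Qed.

Lemma weight0 : weight ip Rt 0.
Proof. by move=> a aR; rewrite ip0l rpred0. Qed.

Lemma weight_root a : a \in Rt -> weight ip Rt a.
Proof. by move=> aR c cR; apply: (roots_crystallographic rsys). Qed.

Lemma weight_cone x : root_cone Rp x -> weight ip Rt x.
Proof.
move=> [k ->] c cR; rewrite ip_suml big_seq rpred_sum// => a aP.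
by rewrite ipMnl rpredMn// weight_root// posR.
Qed.

Lemma weight_weyl w x : W w -> weight ip Rt x -> weight ip Rt (w x).
Proof.
move=> Ww hx a aR; rewrite -[a](weylVK a Ww) weyl_coroot//.
by apply: hx; apply: weyl_root => //; exact: weyl_inv.
Qed.

Definition rho : E := halfsum (fun=> 1).

Lemma rho_simple b : b \in B -> ip rho (cor b) = 1.
Proof. by move=> bB; rewrite halfsum_simple. Qed.

(** A positive root is [w b] with [b] simple, and the pairing of [rho] with its coroot is that of
    [w^-1 rho] with the coroot of [b]; this differs from 1 by an integer, as [rho - w^-1 rho] lies
    in the root cone. *)
Lemma rho_weight : weight ip Rt rho.
Proof.
have pos a : a \in Rp -> ip rho (cor a) \is a Num.int.
  move=> /pos_word[s [b [sB bB ->]]].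
  have Ww : W (word s) := word_weyl sB.
  rewrite -[rho](weylVK rho Ww) weyl_coroot//.
  have rB b' : b' \in B -> ip rho (cor b') \is a Num.nat.
    by move=> b'B; rewrite rho_simple// rpred1.
  have := weight_cone (dominance_weyl rB (weyl_inv Ww)) (subBR bB).
  rewrite ipBl rho_simple// => h.
  by rewrite -[X in X \is a _](subKr 1) rpredB ?rpred1.
move=> a aR; case/orP: (root_posVneg aR) => /pos//.
by rewrite ip_coroot !ipNl !ipNr opprK mulrN rpredN -ip_coroot.
Qed.

Lemma dominant_simple x : weight ip Rt x -> (forall b, b \in B -> 0 <= ip x (cor b)) ->
  dominant ip Rt Rp x.
Proof.
move=> hx xB; split=> // a aP; rewrite natrEint hx ?posR//= ip_coroot.
rewrite mulr_ge0 ?divr_ge0 ?ip_ge0//.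
case: baseB => _ gB _; apply: (cone_nonneg (gB _ aP)) => b bB.
have := xB _ bB; rewrite ip_coroot pmulr_rge0// divr_gt0//.
exact/root_norm_gt0/subBR.
Qed.

Lemma dominant_ge0 x a : dominant ip Rt Rp x -> a \in Rp -> 0 <= ip x a.
Proof.
move=> [_ /(_ a) h] aP; have := natr_ge0 (h aP); rewrite ip_coroot pmulr_rge0//.
by rewrite divr_gt0// root_norm_gt0// posR.
Qed.

Lemma cone_ip_ge0 x y : (forall a, a \in Rp -> 0 <= ip y a) -> root_cone Rp x -> 0 <= ip x y.
Proof.
move=> yP [k ->]; rewrite ip_suml big_seq sumr_ge0// => a aP.
by rewrite ipMnl mulrn_wge0// ipC yP.
Qed.

(** [|y|^2 - |x|^2 = <y - x, x> + <y - x, y>], and both terms are nonnegative. *)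
Lemma cone_norm_le x y : (forall a, a \in Rp -> 0 <= ip x a) ->
  (forall a, a \in Rp -> 0 <= ip y a) -> root_cone Rp (y - x) -> ip x x <= ip y y.
Proof.
move=> hx hy c; have h1 := cone_ip_ge0 hx c; have h2 := cone_ip_ge0 hy c.
rewrite !ipBl (ipC x y) in h1 h2; lra.
Qed.

Lemma ip_cauchy_schwarz x y : ip x y ^+ 2 <= ip x x * ip y y.
Proof.
have [->|/ip_gt0 y0] := eqVneq y 0; first by rewrite !ip0r expr0n mulr0.
have := ip_ge0 (ip y y *: x - ip x y *: y).
rewrite !ipBl !ipBr !ipZl !ipZr (ipC y x) => h.
suff : 0 <= ip y y * (ip x x * ip y y - ip x y ^+ 2) by rewrite pmulr_rge0// subr_ge0.
by apply: le_trans h _; rewrite le_eqVlt; apply/orP; left; apply/eqP; ring.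
Qed.

(** Cauchy-Schwarz bounds the integer pairings with all coroots by a common [N]; shifted by [N] they
    become indices below [N + N + 1], and they determine the weight because the roots span. *)
Lemma finite_weights c : finite_set [set x | weight ip Rt x /\ ip x x <= c].
Proof.
pose K := \sum_(a <- Rt) ip (cor a) (cor a).
pose N := Num.bound (`|c| * K + 1).
have K0 : 0 <= K by rewrite sumr_ge0// => a _; exact: ip_ge0.
have bound x a : ip x x <= c -> a \in Rt -> `|ip x (cor a)| <= N%:R.
  move=> xc aR; set s := ip x (cor a).
  have ca : ip (cor a) (cor a) <= K.
    rewrite /K (big_fsetD1 a)//= lerDl sumr_ge0// => y _; exact: ip_ge0.
  have cs : s ^+ 2 <= ip x x * ip (cor a) (cor a) by exact: ip_cauchy_schwarz.
  have h : s ^+ 2 <= `|c| * K.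
    apply: le_trans cs _; apply: ler_pM => //; try exact: ip_ge0.
    exact: le_trans (ler_norm c).
  have h2 : `|s| <= `|c| * K + 1.
    have := sqr_ge0 (`|s| - 1); rewrite sqrrB1 real_normK ?num_real//.
    have := normr_ge0 s; rewrite -mulr_natl; lra.
  by apply: (le_trans h2); rewrite ltW// archi_boundP// addr_ge0// mulr_ge0.
pose f x : {ffun Rt -> 'I_(N + N).+1} :=
  [ffun a => inord (absz (Num.floor (ip x (cor (val a))) + N%:Z)%R)].
have fi x y : weight ip Rt x -> weight ip Rt y -> ip x x <= c -> ip y y <= c ->
    f x = f y -> x = y.
  move=> wx wy xc yc /ffunP fxy.
  apply/eqP; rewrite -subr_eq0; apply/eqP; apply: (dot_roots_eq0 rsys) => a aR.
  have /(congr1 val) := fxy [` aR]%fset; rewrite !ffunE /=.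
  have bd z : weight ip Rt z -> ip z z <= c ->
      exists m : nat, [/\ Num.floor (ip z (cor a)) + N%:Z = m, (m <= N + N)%N &
        ip z (cor a) = m%:R - N%:R].
    move=> wz zc; have := bound z a zc aR.
    have := wz a aR; rewrite intrEfloor => /eqP e; set k := Num.floor _ in e *.
    rewrite -e -[N%:R]/(N%:Z%:~R) ler_norml -rmorphN !ler_int => /andP[k1 k2].
    have k0 : 0 <= k + N%:Z by lia.
    exists (absz (k + N%:Z)%R); split; [by rewrite gez0_abs|by lia|].
    by rewrite -[(absz _)%:R]/((absz (k + N%:Z)%R)%:Z%:~R) gez0_abs// -intrD addrK.
  have [m [-> mN ex]] := bd x wx xc; have [n [-> nN ey]] := bd y wy yc.
  rewrite !absz_nat !inordK// => mn; have : ip (x - y) (cor a) = 0.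
    by rewrite ipBl ex ey mn subrr.
  by rewrite ip_coroot => /eqP; rewrite mulf_eq0 gt_eqF ?divr_gt0 ?root_norm_gt0//= ipC => /eqP.
(* [g] inverts the encoding [f] on the set, which is thus contained in the image of a finite
   type. *)
pose g y := xget 0 [set x | (weight ip Rt x /\ ip x x <= c) /\ f x = y]%classic.
apply: (@sub_finite_set _ _ (g @` setT)%classic); last exact/finite_image/finite_finset.
move=> x [wx xc]; exists (f x) => //; rewrite /g.
by case: xgetP => [y _ [[wy yc] /fi->//]|/(_ x)[]].
Qed.

(** Take the orbit element of maximal height: a negative pairing with a positive root [a] would let
    the reflection in [a] increase the height. *)
Lemma orbit_dominant x : finite_set (weyl_group ip Rt) ->
  exists2 w, W w & forall a, a \in Rp -> 0 <= ip (w x) a.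
Proof.
move=> fW; have WE w : (w \in fset_set (weyl_group ip Rt)) <-> W w.
  by rewrite in_fset_set// inE.
have mx (l : seq 'End(E)) : l != [::] ->
    exists2 w, w \in l & forall u, u \in l -> ip (u x) v <= ip (w x) v.
  elim: l => // u [_ _|u' l IH _].
    by exists u; rewrite ?inE// => w; rewrite inE => /eqP->.
  have [//|w wl wm] := IH.
  have [le|/ltW le] := leP (ip (u x) v) (ip (w x) v).
    exists w; first by rewrite inE wl orbT.
    by move=> z; rewrite inE => /predU1P[->//|/wm].
  exists u; first by rewrite inE eqxx.
  by move=> z; rewrite inE => /predU1P[->//|/wm h]; exact: le_trans h le.
have [w Ww wmax] : exists2 w, W w & forall u, W u -> ip (u x) v <= ip (w x) v.
  have [|w wW wm] := mx (enum_fset (fset_set (weyl_group ip Rt))).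
    apply/negP => /eqP e; have := (WE \1%VF).2 (weyl_id _ _).
    by rewrite -[_ \in fset_set _]/(_ \in enum_fset _) e.
  by exists w; [exact/WE|move=> u /WE; exact: wm].
exists w => // a aP; have aR := posR aP.
have := wmax _ (weyl_refl aR Ww); rewrite comp_lfunE reflE ipBl ipZl.
rewrite gerBl pmulr_lge0 ?pos_ht// ip_coroot pmulr_rge0//.
by rewrite divr_gt0// root_norm_gt0.
Qed.

(** For a dominant weight [y] these are the weights of the irreducible representation of highest
    weight [y]. Quantifying over the orbit makes the notion [W]-stable and additive in [y], as
    products of trigonometric polynomials require. *)
Definition saturated y xi := forall w, W w -> root_cone Rp (y - w xi).

Lemma saturatedD y z xi eta : saturated y xi -> saturated z eta -> saturated (y + z) (xi + eta).
Proof.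
by move=> hy hz w Ww; rewrite linearD opprD addrACA; apply: root_coneD; [exact: hy|exact: hz].
Qed.

Lemma saturated_weyl y xi u : W u -> saturated y xi -> saturated y (u xi).
Proof. by move=> Wu h w Ww; rewrite -comp_lfunE; apply/h/weyl_mul. Qed.

Lemma saturated_self y : (forall b, b \in B -> ip y (cor b) \is a Num.nat) -> saturated y y.
Proof. by move=> hy w Ww; exact: dominance_weyl. Qed.

Lemma saturated_le y z xi : root_cone Rp (z - y) -> saturated y xi -> saturated z xi.
Proof. by move=> zy h w Ww; rewrite -[z](subrK y) -addrA; apply: root_coneD => //; exact: h. Qed.

Lemma saturated_cone y xi : saturated y xi -> root_cone Rp (y - xi).
Proof. by move=> /(_ _ (weyl_id _ _)); rewrite id_lfunE. Qed.

Lemma saturated_weight y xi : weight ip Rt y -> saturated y xi -> weight ip Rt xi.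
Proof. by move=> wy /saturated_cone/weight_cone h; rewrite -[xi](subKr y); exact: weightB. Qed.

Lemma finite_saturated y : finite_set (weyl_group ip Rt) -> weight ip Rt y ->
  (forall a, a \in Rp -> 0 <= ip y a) -> finite_set [set xi | saturated y xi].
Proof.
move=> fW wy dy; apply: sub_finite_set (finite_weights (ip y y)) => xi h; split.
  exact: saturated_weight h.
have [w Ww wd] := orbit_dominant xi fW.
by rewrite -(weyl_isom xi xi Ww); apply: cone_norm_le => //; exact: h.
Qed.

Lemma finite_dominated y : dominant ip Rt Rp y ->
  finite_set [set x | dominant ip Rt Rp x /\ dominance_le Rp x y].
Proof.
move=> dy; apply: sub_finite_set (finite_weights (ip y y)) => x [dx xy]; split.
  by case: dx.
by apply: cone_norm_le => // a aP; exact: dominant_ge0.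
Qed.

(** The exponents in a product whose factors offer [a / 2] or [- a / 2]. [L] is a list because a
    root occurs in [C] once for each parameter. *)
Fixpoint half_sums (L : seq E) (xi : E) : Prop :=
  if L is a :: L' then exists t eta,
    [/\ t = a \/ t = - a, half_sums L' eta & xi = 2^-1 *: t + eta]
  else xi = 0.

(** Term by term: half of [rabs (w a)] exceeds the image under [w] of [a / 2] or [- a / 2] by 0 or
    by the positive root [rabs (w a)]. *)
Lemma half_sums_saturated L xi w : {subset L <= Rp} -> half_sums L xi -> W w ->
  root_cone Rp (\sum_(a <- L) 2^-1 *: rabs (w a) - w xi).
Proof.
move=> sL h Ww; elim: L xi sL h => [|a L IH] xi sL /=.
  by move=> ->; rewrite big_nil linear0 subr0; exact: root_cone0.
move=> [t [eta [ta heta ->]]]; have aP : a \in Rp by apply: sL; rewrite inE eqxx.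
have sL' : {subset L <= Rp} by move=> b bL; apply: sL; rewrite inE bL orbT.
have hh y : 2^-1 *: y + 2^-1 *: y = y :> E.
  by rewrite -scalerDl -[2^-1]mul1r -splitr scale1r.
have [wt|wt] : w t = rabs (w a) \/ w t = - rabs (w a).
  by case: ta => ->; rewrite ?linearN; case: (rabs_cases (w a)) => ->;
    rewrite ?opprK; [left|right|right|left].
- by rewrite big_cons linearD linearZ /= wt opprD addrACA subrr add0r; exact: IH.
rewrite big_cons linearD linearZ /= wt opprD addrACA scalerN opprK hh.
by apply: root_coneD; [exact/root_cone_pos/rabs_stable|exact: IH].
Qed.

(** * Fourier analysis on the torus *)

Implicit Types (f g : E -> R[i]) (t : R) (nu : E).

Local Notation Re := complex.Re.
Local Notation Im := complex.Im.
Local Notation lat := (coroot_basis ip Rt).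
Local Notation tp := (torus_point ip Rt).

Definition tame f := bounded_lipschitz (fun s => Re (f (tp s))) /\
  bounded_lipschitz (fun s => Im (f (tp s))).

(** The torus integral without its density factor, so that the constant 1 has mean 1. *)
Definition torus_mean f : R[i] :=
  (cube_integral (fun s => Re (f (tp s))) +i* cube_integral (fun s => Im (f (tp s))))%C.

Local Notation I := torus_mean.

Lemma ReM (x y : R[i]) : Re (x * y) = Re x * Re y - Im x * Im y.
Proof. by case: x y => [? ?] [? ?]. Qed.

Lemma ImM (x y : R[i]) : Im (x * y) = Re x * Im y + Im x * Re y.
Proof. by case: x y => [? ?] [? ?]. Qed.

Lemma ReD (x y : R[i]) : Re (x + y) = Re x + Re y.
Proof. by case: x y => [? ?] [? ?]. Qed.

Lemma ImD (x y : R[i]) : Im (x + y) = Im x + Im y.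
Proof. by case: x y => [? ?] [? ?]. Qed.

Lemma ReJ (x : R[i]) : Re x^* = Re x.
Proof. by case: x. Qed.

Lemma ImJ (x : R[i]) : Im x^* = - Im x.
Proof. by case: x. Qed.

Lemma eqC (x y : R[i]) : Re x = Re y -> Im x = Im y -> x = y.
Proof. by case: x y => [? ?] [? ?] /= -> ->. Qed.

Lemma tame_cst (z : R[i]) : tame (fun=> z).
Proof. by split; exact: bl_cst. Qed.

Lemma tameD f g : tame f -> tame g -> tame (fun x => f x + g x).
Proof.
move=> [fr fi] [gr gi]; split.
  by under [X in bounded_lipschitz X]eq_fun do rewrite ReD; exact: bl_add.
by under [X in bounded_lipschitz X]eq_fun do rewrite ImD; exact: bl_add.
Qed.

Lemma tameM f g : tame f -> tame g -> tame (fun x => f x * g x).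
Proof.
move=> [fr fi] [gr gi]; split.
  under [X in bounded_lipschitz X]eq_fun do rewrite ReM.
  by apply: bl_add; [exact: bl_mul|apply/bl_opp/bl_mul].
under [X in bounded_lipschitz X]eq_fun do rewrite ImM.
by apply: bl_add; exact: bl_mul.
Qed.

Lemma tameJ f : tame f -> tame (fun x => (f x)^*).
Proof.
move=> [fr fi]; split.
  by under [X in bounded_lipschitz X]eq_fun do rewrite ReJ.
by under [X in bounded_lipschitz X]eq_fun do rewrite ImJ; exact: bl_opp.
Qed.

Lemma tame_sum (T : eqType) (r : seq T) (F : T -> E -> R[i]) :
  (forall i, i \in r -> tame (F i)) -> tame (fun x => \sum_(i <- r) F i x).
Proof.
elim: r => [|i r IH] h.
  by under [X in tame X]eq_fun do rewrite big_nil; exact: tame_cst.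
under [X in tame X]eq_fun do rewrite big_cons.
apply: tameD; first by apply: h; rewrite inE eqxx.
by apply: IH => j jr; apply: h; rewrite inE jr orbT.
Qed.

Lemma tame_prod (T : eqType) (r : seq T) (F : T -> E -> R[i]) :
  (forall i, i \in r -> tame (F i)) -> tame (fun x => \prod_(i <- r) F i x).
Proof.
elim: r => [|i r IH] h.
  by under [X in tame X]eq_fun do rewrite big_nil; exact: tame_cst.
under [X in tame X]eq_fun do rewrite big_cons.
apply: tameM; first by apply: h; rewrite inE eqxx.
by apply: IH => j jr; apply: h; rewrite inE jr orbT.
Qed.

Definition expo nu x : R[i] := expi (ip nu x).

Lemma ip_torus_point nu s : ip nu (tp s) = 0 + \sum_i tnth s i * (2 * pi * ip nu (tnth lat i)).
Proof.
rewrite add0r /torus_point ip_sumr; apply: eq_bigr => i _; rewrite ipZr.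
by ring.
Qed.

Lemma tame_expo nu : tame (expo nu).
Proof.
split; rewrite /expo /expi /=.
  by under [X in bounded_lipschitz X]eq_fun do rewrite ip_torus_point; exact: bl_cos.
by under [X in bounded_lipschitz X]eq_fun do rewrite ip_torus_point; exact: bl_sin.
Qed.

Lemma expoD nu eta x : expo (nu + eta) x = expo nu x * expo eta x.
Proof. by apply: eqC; rewrite /expo ipDl ?ReM ?ImM /= ?cosD ?sinD//; ring. Qed.

Lemma expo0 x : expo 0 x = 1.
Proof. by rewrite /expo ip0l /expi cos0 sin0. Qed.

Lemma expoJ nu x : (expo nu x)^* = expo (- nu) x.
Proof. by apply: eqC; rewrite ?ReJ ?ImJ /expo ipNl /= ?cosN ?sinN. Qed.

Lemma expoNr nu x : expo nu (- x) = expo (- nu) x.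
Proof. by rewrite /expo ipNr ipNl. Qed.

Lemma expo_weyl w nu x : W w -> expo nu (w x) = expo ((w^-1)%VF nu) x.
Proof. by move=> Ww; rewrite /expo ip_weyl. Qed.

Lemma torus_meanD f g : tame f -> tame g -> I (fun x => f x + g x) = I f + I g.
Proof.
move=> [fr fi] [gr gi]; apply: eqC; rewrite ?ReD ?ImD /= -cube_integralD//;
  by congr cube_integral; apply/funext => s; rewrite ?ReD ?ImD.
Qed.

Lemma torus_meanZ f z : tame f -> I (fun x => z * f x) = z * I f.
Proof.
move=> [fr fi]; apply: eqC; rewrite ?ReM ?ImM /=.
  rewrite -mulNr -!cube_integralZ// -cube_integralD; first last.
  - by apply: bl_mul => //; exact: bl_cst.
  - by apply: bl_mul => //; exact: bl_cst.
  by congr cube_integral; apply/funext => s; rewrite ReM mulNr.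
rewrite -!cube_integralZ// -cube_integralD; first last.
- by apply: bl_mul => //; exact: bl_cst.
- by apply: bl_mul => //; exact: bl_cst.
by congr cube_integral; apply/funext => s; rewrite ImM.
Qed.

Lemma torus_mean_sum (T : eqType) (r : seq T) (F : T -> E -> R[i]) :
  (forall i, i \in r -> tame (F i)) ->
  I (fun x => \sum_(i <- r) F i x) = \sum_(i <- r) I (F i).
Proof.
elim: r => [|i r IH] h.
  rewrite big_nil -[RHS](mul0r (I (fun=> 0))) -torus_meanZ; last exact: tame_cst.
  by congr I; apply/funext => x; rewrite big_nil mul0r.
have hr j : j \in r -> tame (F j) by move=> jr; apply: h; rewrite inE jr orbT.
rewrite big_cons -IH// -torus_meanD; first last.
- exact: tame_sum.
- by apply: h; rewrite inE eqxx.
by congr I; apply/funext => x; rewrite big_cons.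
Qed.

Lemma torus_meanJ f : tame f -> I (fun x => (f x)^*) = (I f)^*.
Proof.
move=> [fr fi]; apply: eqC; rewrite ?ReJ ?ImJ /=.
  by congr cube_integral; apply/funext => s; rewrite ReJ.
rewrite -mulN1r -cube_integralZ//.
by congr cube_integral; apply/funext => s; rewrite ImJ mulN1r.
Qed.

Lemma torus_mean_ge0 f : (forall x, 0 <= f x) -> 0 <= I f.
Proof.
move=> f0; have h x : Im (f x) = 0 /\ 0 <= Re (f x).
  by have := f0 x; rewrite lecE => /andP[/eqP/= <- ->].
rewrite lecE /=; apply/andP; split; last by apply: cube_integral_ge0 => s; case: (h (tp s)).
have -> : (fun s => Im (f (tp s))) = (fun=> 0).
  by apply/funext => s; case: (h (tp s)).
apply/eqP/eqP; rewrite -normr_le0; apply: cube_integral_bound; first exact: bl_cst.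
by move=> s; rewrite normr0.
Qed.

Lemma torus_mean_bound f M : tame f -> (forall s, `|Re (f (tp s))| <= M) ->
  (forall s, `|Im (f (tp s))| <= M) -> `|Re (I f)| <= M /\ `|Im (I f)| <= M.
Proof. by move=> [fr fi] rM iM; split; exact: cube_integral_bound. Qed.

(** The basis vectors are integer combinations of coroots, so [nu] has integer frequencies along the
    cube; the basis spans [E], so these all vanish only for [nu = 0]. *)
Lemma torus_mean_expo nu : weight ip Rt nu -> I (expo nu) = (nu == 0)%:R.
Proof.
move=> wnu; have [basB latB] := coroot_basisP rsys.
pose m i := Num.floor (ip nu (tnth lat i)).
have mE i : (m i)%:~R = ip nu (tnth lat i).
  apply/eqP; rewrite -intrEfloor.
  have [k ->] : coroot_lattice ip Rt (tnth lat i).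
    apply/latB; exists (fun j => (j == i)%:R); rewrite (bigD1 i)//= eqxx big1 ?addr0//.
    by move=> j /negPf ->.
  rewrite ip_sumr big_seq rpred_sum// => a aR.
  by rewrite -scaler_int ipZr rpredM ?intr_int ?wnu.
have sE s : ip nu (tp s) = 0 + \sum_i 2 * pi * tnth s i * (m i)%:~R.
  by rewrite ip_torus_point; congr (_ + _); apply: eq_bigr => i _; rewrite mE; ring.
have nuE : [forall i, m i == 0] = (nu == 0).
  apply/forallP/eqP => [m0|nu0 i]; last by rewrite /m nu0 ip0l floor0.
  apply/eqP/negPn/negP => /ip_gt0.
  have nub : nu \in <<lat>>%VS by move: basB => /andP[/eqP -> _]; rewrite memvf.
  rewrite {2}(coord_span nub) ip_sumr big1 ?ltxx// => i _.
  by rewrite ipZr -tnth_nth -mE (eqP (m0 i)) mulr0.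
apply: eqC; rewrite /= /expo /expi /=.
  transitivity (cube_integral (fun s : (\dim {:E}).-tuple R =>
    cos (0 + \sum_i 2 * pi * tnth s i * (m i)%:~R))).
    by congr cube_integral; apply/funext => s; rewrite sE.
  by rewrite cube_integral_cos nuE cos0; case: eqP.
transitivity (cube_integral (fun s : (\dim {:E}).-tuple R =>
  sin (0 + \sum_i 2 * pi * tnth s i * (m i)%:~R))).
  by congr cube_integral; apply/funext => s; rewrite sE.
by rewrite cube_integral_sin nuE sin0; case: eqP.
Qed.

(** * Geometric factors and their means *)

Local Notation fac t nu x := (1 + (t%:C)%C * expo nu x).

Lemma fac_neq0 t nu x : -1 < t < 1 -> fac t nu x != 0.
Proof.
move=> t1; set c := cos (ip nu x); set s := sin (ip nu x).
have cs : c ^+ 2 + s ^+ 2 = 1 by exact: cos2Dsin2.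
apply/negP => /eqP/(congr1 (fun z => (Re z, Im z))) [].
(* A zero would give [t c = -1] and [t s = 0], hence [t^2 = 1]. *)
rewrite !mul0r subr0 addr0 add0r -/c -/s => h1 h2; nra.
Qed.

(** The inverse is the conjugate divided by [D = |1 + t z|^2], and [D >= (1 - |t|)^2 > 0]. *)
Lemma tame_facV t nu : -1 < t < 1 -> tame (fun x => (fac t nu x)^-1).
Proof.
move=> /andP[t1 t2].
pose c x := cos (ip nu x); pose s x := sin (ip nu x).
pose D x := 1 + 2 * t * c x + t ^+ 2.
have cs x : c x ^+ 2 + s x ^+ 2 = 1 by exact: cos2Dsin2.
have [cr ci] := tame_expo nu.
have c1 x : -1 <= c x <= 1 by rewrite cos_geN1 cos_le1.
have Dge x : (1 - `|t|) ^+ 2 <= D x.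
  have /andP[h1 h2] := c1 x; rewrite /D; have [t0|t0] := leP 0 t.
    rewrite ger0_norm//; nra.
  rewrite ltr0_norm//; nra.
have D0 : 0 < (1 - `|t|) ^+ 2.
  by rewrite exprn_gt0// subr_gt0 ltr_norml t1 t2.
have DE x : (1 + t * c x) ^+ 2 + (t * s x) ^+ 2 = D x.
  by rewrite /D; have := cs x; nra.
have blD : bounded_lipschitz (fun u => (D (tp u))^-1).
  apply: bl_inv D0 _ _ => [u|]; first exact: Dge.
  apply: bl_add; last exact: bl_cst.
  by apply: bl_add; [exact: bl_cst|apply: bl_mul => //; exact: bl_cst].
have E1 x : Re (fac t nu x)^-1 = (1 + t * c x) * (D x)^-1.
  rewrite -DE /expo /expi /= !mul0r subr0 addr0 add0r //.
have E2 x : Im (fac t nu x)^-1 = - (t * s x) * (D x)^-1.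
  by rewrite -DE /expo /expi /= !mul0r subr0 addr0 add0r mulNr.
split.
  under [X in bounded_lipschitz X]eq_fun do rewrite E1.
  apply: bl_mul => //; apply: bl_add; first exact: bl_cst.
  by apply: bl_mul => //; exact: bl_cst.
under [X in bounded_lipschitz X]eq_fun do rewrite E2.
apply: bl_mul => //; apply: bl_opp.
by apply: bl_mul => //; exact: bl_cst.
Qed.

(** Taken at the list [C_factors], this is [1 / C(-x)]. *)
Definition poisson (L : seq (R * E)) x : R[i] := \prod_(p <- L) (fac p.1 p.2 x)^-1.

Definition small (L : seq (R * E)) := forall p, p \in L -> -1 < p.1 < 1 /\ p.2 \in Rp.

Lemma small_cons p L : small (p :: L) -> [/\ -1 < p.1 < 1, p.2 \in Rp & small L].
Proof.
move=> h; have [h1 h2] : -1 < p.1 < 1 /\ p.2 \in Rp by apply: h; rewrite inE eqxx.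
by split=> // q qL; apply: h; rewrite inE qL orbT.
Qed.

Lemma tame_expo_weyl w nu : W w -> tame (fun x => expo nu (w x)).
Proof.
move=> Ww; under [X in tame X]eq_fun do rewrite expo_weyl//.
exact: tame_expo.
Qed.

Lemma tame_facV_weyl w t nu : W w -> -1 < t < 1 -> tame (fun x => (fac t nu (w x))^-1).
Proof.
move=> Ww t1; under [X in tame X]eq_fun do rewrite expo_weyl//.
exact: tame_facV.
Qed.

Lemma tame_poisson_weyl w L : W w -> small L -> tame (fun x => poisson L (w x)).
Proof.
move=> Ww sL; apply: tame_prod => p pL; apply: tame_facV_weyl => //.
by have [] := sL p pL.
Qed.

Lemma bounded_geometric_eq0 (z r M : R) : -1 < r < 1 -> (forall n, `|z| <= `|r| ^+ n * M) -> z = 0.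
Proof.
move=> r1 zM; apply/eqP; rewrite -normr_le0 leNgt; apply/negP => z0.
have h : ((geometric M `|r|) @ \oo --> (0 : R))%classic.
  by apply: cvg_geometric; rewrite normr_id ltr_norml.
have /cvgrPdist_lt/(_ _ z0)[N _ /(_ N (leqnn N))] := h.
rewrite sub0r normrN /geometric /= ltNge mulrC => /negP; apply.
exact: le_trans (zM N) (ler_norm _).
Qed.

(* Peeling off one factor gives [F k + t F (k + 1) = 0] for the means [F k] of
   the frequencies [nu + k a], so that [F 0 = (-t)^n F n] tends to 0. *)
Lemma torus_mean_poisson w L nu : W w -> small L -> weight ip Rt nu ->
  ~ root_cone Rp (- nu) -> I (fun x => expo nu (w x) * poisson L (w x)) = 0.
Proof.
move=> Ww; elim: L nu => [|[t a] L IH] nu sL wnu ncone.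
  transitivity (I (expo ((w^-1)%VF nu))).
    by congr I; apply/funext => x; rewrite /poisson big_nil mulr1 expo_weyl.
  rewrite torus_mean_expo; last by apply: weight_weyl => //; exact: weyl_inv.
  case: eqP => // h; case: ncone; have := weylVK nu Ww; rewrite h linear0 => <-.
  by rewrite oppr0; exact: root_cone0.
have [/= t1 aP sL'] := small_cons sL.
pose F k := I (fun x => expo (nu + a *+ k) (w x) * poisson ((t, a) :: L) (w x)).
have wk k : weight ip Rt (nu + a *+ k).
  by apply: weightD => //; apply: weight_cone; exact/root_coneMn/root_cone_pos.
(* Adding positive roots to [nu] keeps [- nu] outside the cone, so the induction hypothesis on [L]
   applies to every shifted frequency. *)
have nk k : ~ root_cone Rp (- (nu + a *+ k)).
  move=> h; apply: ncone; rewrite -[- nu](subrK (a *+ k)) -opprD.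
  by apply: root_coneD => //; exact/root_coneMn/root_cone_pos.
have tk k : tame (fun x => expo (nu + a *+ k) (w x) * poisson ((t, a) :: L) (w x)).
  by apply: tameM; [exact: tame_expo_weyl|exact: tame_poisson_weyl].
have rec k : F k = - (t%:C)%C * F k.+1.
  apply/eqP; rewrite mulNr -addr_eq0 /F -torus_meanZ// -torus_meanD//; last first.
    by apply: tameM => //; exact: tame_cst.
  rewrite -[X in _ == X](IH (nu + a *+ k) sL' (wk k) (nk k)); apply/eqP; congr I; apply/funext => x.
  rewrite /poisson !big_cons /= mulrS [a + _]addrC addrA (expoD _ a).
  have := fac_neq0 a (w x) t1; set u := expo a _ => h.
  by field; exact: h.
have FN n : F 0%N = (- (t%:C)%C) ^+ n * F n.
  elim: n => [|n IHn]; first by rewrite expr0 mul1r.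
  by rewrite IHn rec exprSr mulrA.
have [[K [M [_ rM _]]] [K' [M' [_ iM _]]]] := tame_poisson_weyl Ww sL.
have bnd k : `|Re (F k)| <= M + M' /\ `|Im (F k)| <= M + M'.
  have bM (c s y z Y Z : R) : `|c| <= 1 -> `|s| <= 1 -> `|y| <= Y -> `|z| <= Z ->
      `|c * y + s * z| <= Y + Z.
    move=> c1 s1 yM zM; apply: le_trans (ler_normD _ _) _; rewrite !normrM.
    by apply: lerD; rewrite -[leRHS]mul1r ler_pM.
  have c1 y : `|cos y| <= 1 :> R by rewrite ler_norml cos_geN1 cos_le1.
  have s1 y : `|sin y| <= 1 :> R by rewrite ler_norml sin_geN1 sin_le1.
  apply: torus_mean_bound => // s.
    by rewrite ReM -mulNr; apply: bM => //; rewrite ?normrN; [exact: c1|exact: s1].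
  by rewrite ImM [M + M']addrC; apply: bM => //; [exact: c1|exact: s1].
have RF n : Re (F 0%N) = (- t) ^+ n * Re (F n) /\ Im (F 0%N) = (- t) ^+ n * Im (F n).
  by rewrite {1 2}(FN n) -rmorphN -rmorphXn ReM ImM /= !mul0r subr0 addr0.
have -> : (fun x => expo nu (w x) * poisson ((t, a) :: L) (w x)) =
    fun x => expo (nu + a *+ 0) (w x) * poisson ((t, a) :: L) (w x).
  by apply/funext => x; rewrite mulr0n addr0.
rewrite -/(F 0%N); have z1 : Re (F 0%N) = 0.
  apply: (bounded_geometric_eq0 (M := M + M') t1) => n; have [-> _] := RF n.
  by rewrite normrM normrX normrN ler_wpM2l ?exprn_ge0//; case: (bnd n).
have z2 : Im (F 0%N) = 0.
  apply: (bounded_geometric_eq0 (M := M + M') t1) => n; have [_ ->] := RF n.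
  by rewrite normrM normrX normrN ler_wpM2l ?exprn_ge0//; case: (bnd n).
exact: eqC.
Qed.

(** Adding [t] times the mean at frequency [a] cancels the first factor, and that mean is 0 because
    [- a] is not in the root cone. *)
Lemma torus_mean_poisson1 w L : W w -> small L -> I (fun x => poisson L (w x)) = 1.
Proof.
move=> Ww; elim: L => [|[t a] L IH] sL.
  transitivity (I (expo 0)).
    by congr I; apply/funext => x; rewrite /poisson big_nil expo0.
  by rewrite torus_mean_expo ?eqxx//; exact: weight0.
have [/= t1 aP sL'] := small_cons sL.
have z : I (fun x => expo a (w x) * poisson ((t, a) :: L) (w x)) = 0.
  apply: torus_mean_poisson => //; first by apply: weight_root; exact: posR.
  by move=> /root_cone_ht; rewrite ipNl oppr_ge0 leNgt pos_ht.
rewrite -[LHS]addr0 -(mulr0 (t%:C)%C) -z -torus_meanZ; last first.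
  by apply: tameM; [exact: tame_expo_weyl|exact: tame_poisson_weyl].
rewrite -torus_meanD; first last.
- apply: tameM; first exact: tame_cst.
  by apply: tameM; [exact: tame_expo_weyl|exact: tame_poisson_weyl].
- exact: tame_poisson_weyl.
rewrite -(IH sL'); congr I; apply/funext => x.
rewrite /poisson !big_cons /=; have := fac_neq0 a (w x) t1; set u := expo a _ => h.
by field; exact: h.
Qed.

(** The list may repeat frequencies or carry zero coefficients, so sums are concatenations; [X] is
    only an upper bound, and [coef] recovers the actual coefficients. *)
Definition has_spectrum (X : E -> Prop) f := exists l : seq (R[i] * E),
  (forall p, p \in l -> X p.2) /\ forall x, f x = \sum_(p <- l) p.1 * expo p.2 x.

Lemma spectrum_sub (X Y : E -> Prop) f : (forall nu, X nu -> Y nu) ->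
  has_spectrum X f -> has_spectrum Y f.
Proof. by move=> XY [l [lX fE]]; exists l; split=> // p /lX/XY. Qed.

Lemma spectrum_expo (X : E -> Prop) nu : X nu -> has_spectrum X (expo nu).
Proof.
move=> Xn; exists [:: (1, nu)]; split=> [p|x]; first by rewrite inE => /eqP->.
by rewrite big_seq1 mul1r.
Qed.

Lemma spectrum_eq (X : E -> Prop) f g : f =1 g -> has_spectrum X f -> has_spectrum X g.
Proof. by move=> /funext->. Qed.

Lemma spectrum0 (X : E -> Prop) : has_spectrum X (fun=> 0).
Proof. by exists [::]; split=> // x; rewrite big_nil. Qed.

Lemma spectrumD (X : E -> Prop) f g : has_spectrum X f -> has_spectrum X g ->
  has_spectrum X (fun x => f x + g x).
Proof.
move=> [l [lX fE]] [k [kX gE]]; exists (l ++ k); split=> [p|x].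
  by rewrite mem_cat => /orP[/lX|/kX].
by rewrite big_cat fE gE.
Qed.

Lemma spectrumM (X Y Z : E -> Prop) f g :
  (forall nu eta, X nu -> Y eta -> Z (nu + eta)) ->
  has_spectrum X f -> has_spectrum Y g -> has_spectrum Z (fun x => f x * g x).
Proof.
move=> XYZ [l [lX fE]] [k [kY gE]].
exists [seq (p.1 * q.1, p.2 + q.2) | p <- l, q <- k]; split=> [_ /allpairsP[[p q] /= [pl qk ->]]|x].
  exact: XYZ (lX p pl) (kY q qk).
rewrite big_allpairs_dep fE gE mulr_suml; apply: eq_bigr => p _.
rewrite mulr_sumr; apply: eq_bigr => q _ /=; rewrite expoD; ring.
Qed.

Lemma spectrumZ (X : E -> Prop) f z : has_spectrum X f -> has_spectrum X (fun x => z * f x).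
Proof.
move=> [l [lX fE]]; exists [seq (z * p.1, p.2) | p <- l]; split=> [_ /mapP[p /lX Xp ->]//|x].
by rewrite big_map fE mulr_sumr; apply: eq_bigr => p _ /=; rewrite mulrA.
Qed.

Lemma spectrum_sum (X : E -> Prop) (T : eqType) (r : seq T) (F : T -> E -> R[i]) :
  (forall i, i \in r -> has_spectrum X (F i)) -> has_spectrum X (fun x => \sum_(i <- r) F i x).
Proof.
elim: r => [|i r IH] h.
  by under [Z in has_spectrum _ Z]eq_fun do rewrite big_nil; exact: spectrum0.
under [Z in has_spectrum _ Z]eq_fun do rewrite big_cons.
apply: spectrumD; first by apply: h; rewrite inE eqxx.
by apply: IH => j jr; apply: h; rewrite inE jr orbT.
Qed.

Lemma spectrum_weyl (X Y : E -> Prop) w f : W w -> (forall nu, X nu -> Y ((w^-1)%VF nu)) ->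
  has_spectrum X f -> has_spectrum Y (fun x => f (w x)).
Proof.
move=> Ww XY [l [lX fE]]; exists [seq (p.1, (w^-1)%VF p.2) | p <- l].
split=> [_ /mapP[p /lX/XY Yp ->]//|x].
by rewrite fE big_map; apply: eq_bigr => p _; rewrite expo_weyl.
Qed.

Lemma tame_spectrum (X : E -> Prop) f : has_spectrum X f -> tame f.
Proof.
move=> [l [_ /funext->]]; apply: tame_sum => p _.
by apply: tameM; [exact: tame_cst|exact: tame_expo].
Qed.

(** * Fourier coefficients *)

Definition coef nu f : R[i] := I (fun x => f x * expo (- nu) x).

Lemma coefD nu f g : tame f -> tame g -> coef nu (fun x => f x + g x) = coef nu f + coef nu g.
Proof.
move=> tf tg; rewrite /coef -torus_meanD; first last.
- by apply: tameM => //; exact: tame_expo.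
- by apply: tameM => //; exact: tame_expo.
by congr I; apply/funext => x; rewrite mulrDl.
Qed.

Lemma coefZ nu f z : tame f -> coef nu (fun x => z * f x) = z * coef nu f.
Proof.
move=> tf; rewrite /coef -torus_meanZ; first by congr I; apply/funext => x; rewrite mulrA.
by apply: tameM => //; exact: tame_expo.
Qed.

Lemma coef_expo nu eta : weight ip Rt nu -> weight ip Rt eta ->
  coef nu (expo eta) = (eta == nu)%:R.
Proof.
move=> wn we; rewrite /coef; under [X in I X]eq_fun do rewrite -expoD.
by rewrite torus_mean_expo ?subr_eq0//; exact: weightB.
Qed.

Lemma coef_sum (T : eqType) (r : seq T) (F : T -> E -> R[i]) nu :
  (forall i, i \in r -> tame (F i)) ->
  coef nu (fun x => \sum_(i <- r) F i x) = \sum_(i <- r) coef nu (F i).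
Proof.
move=> h; rewrite /coef -torus_mean_sum; last first.
  by move=> i ir; apply: tameM; [exact: h|exact: tame_expo].
by congr I; apply/funext => x; rewrite mulr_suml.
Qed.

Lemma coef_list nu (l : seq (R[i] * E)) : weight ip Rt nu ->
  (forall p, p \in l -> weight ip Rt p.2) ->
  coef nu (fun x => \sum_(p <- l) p.1 * expo p.2 x) = \sum_(p <- l) p.1 * (p.2 == nu)%:R.
Proof.
move=> wn wl; rewrite (coef_sum (F := fun p x => p.1 * expo p.2 x)); last first.
  by move=> p _; apply: tameM; [exact: tame_cst|exact: tame_expo].
rewrite big_seq [RHS]big_seq; apply: eq_bigr => p pl.
by rewrite coefZ ?coef_expo//; [exact: wl|exact: tame_expo].
Qed.

Lemma coef_notin (X : E -> Prop) nu f : (forall eta, X eta -> weight ip Rt eta) ->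
  weight ip Rt nu -> has_spectrum X f -> ~ X nu -> coef nu f = 0.
Proof.
move=> Xw wn [l [lX /funext->]] nX; rewrite coef_list//; last by move=> p /lX/Xw.
rewrite big_seq big1// => p pl; case: eqP => [e|_]; last by rewrite mulr0.
by case: nX; rewrite -e; exact: lX.
Qed.

Lemma spectrum_expand (X : E -> Prop) (s : seq E) f : uniq s -> (forall eta, X eta -> eta \in s) ->
  (forall eta, eta \in s -> weight ip Rt eta) -> has_spectrum X f ->
  forall x, f x = \sum_(nu <- s) coef nu f * expo nu x.
Proof.
move=> us Xs sw [l [lX fE]] x; rewrite fE; move: fE => /funext->.
have -> : \sum_(nu <- s) coef nu (fun x => \sum_(p <- l) p.1 * expo p.2 x) * expo nu x =
    \sum_(nu <- s) \sum_(p <- l) p.1 * (p.2 == nu)%:R * expo nu x.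
  rewrite big_seq [RHS]big_seq; apply: eq_bigr => nu ns.
  rewrite coef_list ?mulr_suml//; first exact: sw.
  by move=> p /lX/Xs/sw.
rewrite exchange_big /= big_seq [RHS]big_seq; apply: eq_bigr => p /lX/Xs ps.
rewrite (bigD1_seq p.2)//= eqxx mulr1 big1 ?addr0// => nu nup.
by rewrite eq_sym (negPf nup) mulr0 mul0r.
Qed.

Lemma coef_weyl (X : E -> Prop) w nu f : W w -> (forall eta, X eta -> weight ip Rt eta) ->
  weight ip Rt nu -> has_spectrum X f ->
  coef ((w^-1)%VF nu) (fun x => f (w x)) = coef nu f.
Proof.
move=> Ww Xw wn [l [lX /funext->]]; rewrite coef_list//; last by move=> p /lX/Xw.
have -> : (fun x => \sum_(p <- l) p.1 * expo p.2 (w x)) =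
    fun x => \sum_(p <- [seq (p.1, (w^-1)%VF p.2) | p <- l]) p.1 * expo p.2 x.
  by apply/funext => x; rewrite big_map; apply: eq_bigr => p _; rewrite expo_weyl.
rewrite coef_list; first last.
- by move=> _ /mapP[p /lX/Xw wp ->]; apply: weight_weyl => //; exact: weyl_inv.
- by apply: weight_weyl => //; exact: weyl_inv.
rewrite big_map; apply: eq_bigr => p _ /=; congr (_ * (nat_of_bool _)%:R).
by apply/eqP/eqP => [/(congr1 w)|->//]; rewrite !weylVK.
Qed.

(* With signs [t = -1] this is the Weyl denominator; with the parameters [t] of
   [C] it is [C] times [expo rhoC]. *)
Definition half_prod (L : seq (R * E)) x : R[i] :=
  \prod_(p <- L) (expo (2^-1 *: p.2) x + (p.1%:C)%C * expo (- (2^-1 *: p.2)) x).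

(** The top frequency takes [a / 2] from every factor; each choice of [- a / 2] lowers the height by
    [ip a v > 0]. *)
Lemma half_prod_spectrum L : (forall p, p \in L -> p.2 \in Rp) ->
  let top := \sum_(p <- L) 2^-1 *: p.2 in
  exists g, has_spectrum (fun nu => half_sums [seq p.2 | p <- L] nu /\ ip nu v < ip top v) g /\
    forall x, half_prod L x = expo top x + g x.
Proof.
elim: L => [|[t a] L IH] pL /=.
  exists (fun=> 0); split; first exact: spectrum0.
  by move=> x; rewrite /half_prod !big_nil expo0 addr0.
have aP : a \in Rp by apply: (pL (t, a)); rewrite inE eqxx.
have pL' p : p \in L -> p.2 \in Rp by move=> h; apply: pL; rewrite inE h orbT.
have [g [gs gE]] := IH pL'; rewrite big_cons /=; set T := \sum_(p <- L) _ in gs gE *.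
have hs : half_sums [seq p.2 | p <- L] T.
  rewrite /T; elim: (L) => [|p M IHM] /=; first by rewrite big_nil.
  by exists p.2, (\sum_(q <- M) 2^-1 *: q.2); split; rewrite ?big_cons//; left.
exists (fun x => expo (2^-1 *: a) x * g x +
  ((t%:C)%C * expo (- (2^-1 *: a)) x * expo T x + (t%:C)%C * expo (- (2^-1 *: a)) x * g x)).
have a0 : 0 < 2^-1 * ip a v by rewrite mulr_gt0// pos_ht.
have sA : has_spectrum (fun nu => nu = - (2^-1 *: a)) (fun x => (t%:C)%C * expo (- (2^-1 *: a)) x).
  exact/spectrumZ/spectrum_expo.
split; last first.
  by move=> x; rewrite /half_prod big_cons -/(half_prod L x) gE /= expoD; ring.
apply: spectrumD.
  apply: (spectrumM _ (spectrum_expo (X := eq (2^-1 *: a)) erefl) gs) => nu eta <- [he lt].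
  split; last by rewrite !ipDl ltrD2l.
  by exists a, eta; split=> //; left.
apply: spectrumD.
  apply: (spectrumM _ sA (spectrum_expo (X := fun nu => nu = T) erefl)) => nu eta -> ->.
  split; last by rewrite !ipDl ltrD2r ipNl ipZl; lra.
  by exists (- a), T; split=> //; [right|rewrite scalerN].
apply: (spectrumM _ sA gs) => nu eta -> [he lt].
split; last by rewrite !ipDl ipNl ipZl; lra.
by exists (- a), eta; split=> //; [right|rewrite scalerN].
Qed.

(** * Weyl denominator and antisymmetric polynomials *)

Hypothesis weyl_finite : finite_set (weyl_group ip Rt).

Definition weyl_seq : seq 'End(E) := enum_fset (fset_set (weyl_group ip Rt)).

Lemma mem_weyl_seq w : (w \in weyl_seq) <-> W w.
Proof. by rewrite -[w \in weyl_seq]/(w \in fset_set _) in_fset_set// inE. Qed.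

Lemma weyl_sumE (V : nmodType) (F : 'End(E) -> V) :
  \sum_(w \in weyl_group ip Rt) F w = \sum_(w <- weyl_seq) F w.
Proof. exact: fsbig_finite. Qed.

Lemma weyl_sum_mulr (V : nmodType) (F : 'End(E) -> V) u : W u ->
  \sum_(w <- weyl_seq) F (w \o u)%VF = \sum_(w <- weyl_seq) F w.
Proof.
move=> Wu; have uu : uniq [seq (w \o u)%VF | w <- weyl_seq].
  rewrite map_inj_uniq ?fset_uniq// => w1 w2 /lfunP e; apply/lfunP => x.
  by have := e ((u^-1)%VF x); rewrite !comp_lfunE weylVK.
have p : perm_eq [seq (w \o u)%VF | w <- weyl_seq] weyl_seq.
  apply: uniq_perm => //; first exact: fset_uniq.
  apply: (uniq_min_size uu _ _).2; last by rewrite size_map.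
  move=> _ /mapP[w /mem_weyl_seq Ww ->]; apply/mem_weyl_seq; exact: weyl_mul.
by rewrite -[RHS](perm_big _ p) big_map.
Qed.

Definition stab_card mu : R[i] := #|` fset_set (stabilizer ip Rt mu)|%:R.

Lemma stab_card_neq0 mu : stab_card mu != 0.
Proof.
have fS : finite_set (stabilizer ip Rt mu) by apply: sub_finite_set weyl_finite => w [].
rewrite /stab_card pnatr_eq0 cardfs_eq0; apply/negP => /eqP e.
have : \1%VF \in fset_set (stabilizer ip Rt mu).
  by rewrite in_fset_set// inE; split; [exact: weyl_id|rewrite id_lfunE].
by rewrite e inE.
Qed.

Local Notation mono := (monomial_sym ip Rt).

Lemma monoE mu x : mono mu x = (stab_card mu)^-1 * \sum_(w <- weyl_seq) expo mu (w x).
Proof. by rewrite /monomial_sym weyl_sumE. Qed.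

Lemma mono_weyl mu u x : W u -> mono mu (u x) = mono mu x.
Proof.
move=> Wu; rewrite !monoE; congr (_ * _).
rewrite -[RHS](weyl_sum_mulr (fun w => expo mu (w x)) Wu).
by apply: eq_bigr => w _; rewrite comp_lfunE.
Qed.

Lemma dominant_nat mu : dominant ip Rt Rp mu -> forall b, b \in B -> ip mu (cor b) \is a Num.nat.
Proof. by move=> [_ h] b bB; apply/h/subB. Qed.

Lemma mono_spectrum mu : dominant ip Rt Rp mu -> has_spectrum (saturated mu) (mono mu).
Proof.
move=> dmu; apply: (spectrum_eq (fun x => esym (monoE mu x))); apply: spectrumZ.
apply: spectrum_sum => w /mem_weyl_seq Ww.
apply: (spectrum_weyl Ww (X := saturated mu)); last exact/spectrum_expo/saturated_self/dominant_nat.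
by move=> nu; apply: saturated_weyl; exact: weyl_inv.
Qed.

Definition delta_factors : seq (R * E) := [seq (-1, a) | a <- Rp].

Local Notation delta := (weyl_denominator ip Rp).

Lemma deltaE x : delta x = half_prod delta_factors x.
Proof.
rewrite /half_prod big_map; apply: eq_bigr => a _ /=.
have -> : ((-1)%:C)%C = -1 :> R[i] by rewrite rmorphN1.
by rewrite mulN1r /expo ipNl ipZl mulrC.
Qed.

Lemma delta_top : \sum_(p <- delta_factors) 2^-1 *: p.2 = rho.
Proof. by rewrite big_map /rho /halfsum; apply: eq_bigr => a _; rewrite div1r. Qed.

Lemma delta_half_sums nu : half_sums Rp nu -> saturated rho nu.
Proof.
move=> h w Ww; have := half_sums_saturated (fun _ => id) h Ww.
rewrite -(big_map (fun a => rabs (w a)) xpredT (fun b => 2^-1 *: b)).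
rewrite (perm_big _ (perm_rabs Ww _ _))//; last by move=> a; exact: rabs_stable.
by rewrite /rho /halfsum; under [X in _ -> root_cone Rp (X - _)]eq_bigr do rewrite div1r.
Qed.

Lemma delta_lead : exists g, [/\ has_spectrum (fun nu => saturated rho nu /\ ip nu v < ip rho v) g &
  forall x, delta x = expo rho x + g x].
Proof.
have [|g [gs gE]] := @half_prod_spectrum delta_factors; first by move=> _ /mapP[a aP ->].
rewrite delta_top in gs gE; exists g; split; last by move=> x; rewrite deltaE gE.
apply: spectrum_sub gs => nu [h lt]; split=> //; apply: delta_half_sums.
by move: h; rewrite -map_comp map_id.
Qed.

Lemma rho_nat b : b \in B -> ip rho (cor b) \is a Num.nat.
Proof. by move=> bB; rewrite rho_simple// rpred1. Qed.

Lemma delta_spectrum : has_spectrum (saturated rho) delta.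
Proof.
have [g [gs gE]] := delta_lead; apply: (spectrum_eq (fun x => esym (gE x))).
apply: spectrumD; first exact/spectrum_expo/saturated_self/rho_nat.
by apply: spectrum_sub gs => nu [].
Qed.

(** The exponents are moved by [w^-1], which permutes the factors up to sign, each odd in its
    root. *)
Lemma delta_weyl w x : W w -> delta (w x) = eps (w^-1)%VF * delta x.
Proof.
move=> Ww; pose d a := expo (2^-1 *: a) x - expo (- (2^-1 *: a)) x.
have Wi := weyl_inv Ww.
have dE y : delta y = \prod_(a <- Rp) (expo (2^-1 *: a) y - expo (- (2^-1 *: a)) y).
  by apply: eq_bigr => a _; rewrite /expo ipNl ipZl mulrC.
have dr a : d a = rsgn a * d (rabs a).
  rewrite /d /rsgn /rabs; case: ifP => _; first by rewrite mul1r.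
  by rewrite mulN1r scalerN opprK opprB.
transitivity (\prod_(a <- Rp) d ((w^-1)%VF a)).
  rewrite dE; apply: eq_bigr => a _; rewrite !expo_weyl//.
  have e : (w^-1)%VF (2^-1 *: a) = 2^-1 *: (w^-1)%VF a by rewrite linearZ.
  have eN : (w^-1)%VF (- (2^-1 *: a)) = - (2^-1 *: (w^-1)%VF a) by rewrite -e; exact: linearN.
  by rewrite e eN.
under eq_bigr do rewrite dr; rewrite big_split /=; congr (_ * _).
rewrite dE -[RHS](perm_big _ (perm_rabs Wi (fun _ h => h) (fun a => rabs_stable Wi))).
by rewrite big_map.
Qed.

Lemma delta_simple b x : b \in B -> delta (refl b x) = - delta x.
Proof.
move=> bB; rewrite delta_weyl; last exact/weyl_reflection/subBR.
by rewrite (refl_inv (subBR bB)) eps_simple// mulN1r.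
Qed.

Lemma dmono_spectrum mu : dominant ip Rt Rp mu ->
  has_spectrum (saturated (mu + rho)) (fun x => delta x * mono mu x).
Proof.
move=> dmu; apply: (spectrumM _ delta_spectrum (mono_spectrum dmu)) => nu eta h1 h2.
by rewrite [nu + _]addrC; exact: saturatedD.
Qed.

(** Every [w^-1 mu] has height at most that of [mu], and all terms of [delta] except [expo rho] lie
    below [rho]. Hence only [w] fixing [mu] reach [mu + rho], each with coefficient 1, and the
    identity is among them. *)
Lemma coef_dmono_neq0 mu : dominant ip Rt Rp mu ->
  coef (mu + rho) (fun x => delta x * mono mu x) != 0.
Proof.
move=> dmu; have wmr : weight ip Rt (mu + rho) by apply: weightD; [case: dmu|exact: rho_weight].
have [g [gs gE]] := delta_lead.
have -> : (fun x => delta x * mono mu x) =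
    fun x => (stab_card mu)^-1 * \sum_(w <- weyl_seq) (delta x * expo ((w^-1)%VF mu) x).
  apply/funext => x; rewrite monoE mulrCA mulr_sumr; congr (_ * _).
  by apply: eq_big_seq => w /mem_weyl_seq Ww; rewrite expo_weyl.
have td eta : tame (fun x => delta x * expo eta x).
  by apply: tameM; [exact: tame_spectrum delta_spectrum|exact: tame_expo].
rewrite coefZ; last exact: tame_sum.
rewrite mulf_neq0 ?invr_eq0 ?stab_card_neq0// coef_sum//.
have cE w : W w ->
    coef (mu + rho) (fun x => delta x * expo ((w^-1)%VF mu) x) = ((w^-1)%VF mu == mu)%:R.
  move=> Ww; set eta := (w^-1)%VF mu.
  have weta : weight ip Rt eta by apply: weight_weyl; [exact: weyl_inv|case: dmu].
  have ht : ip eta v <= ip mu v.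
    rewrite -subr_ge0 -ipBl; apply: root_cone_ht; apply: dominance_weyl; last exact: weyl_inv.
    exact: dominant_nat.
  have -> : (fun x => delta x * expo eta x) = fun x => expo (rho + eta) x + g x * expo eta x.
    by apply/funext => x; rewrite gE mulrDl expoD.
  have gsp : has_spectrum (fun nu => weight ip Rt nu /\ ip nu v < ip (mu + rho) v)
      (fun x => g x * expo eta x).
    apply: (spectrumM _ gs (spectrum_expo (X := fun nu => nu = eta) erefl)) => nu _ [snu lt] ->.
    split; first by apply: weightD => //; exact: saturated_weight rho_weight snu.
    by rewrite !ipDl addrC ler_ltD.
  rewrite coefD; [|exact: tame_expo|exact: tame_spectrum gsp].
  rewrite (coef_notin _ _ gsp)//; [|by move=> ? []|by rewrite ltxx => -[]].
  rewrite addr0 coef_expo//; last by apply: weightD => //; exact: rho_weight.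
  by rewrite addrC (inj_eq (addIr rho)).
rewrite big_seq (eq_bigr (fun w => ((w^-1)%VF mu == mu)%:R)); last by move=> w /mem_weyl_seq/cE.
rewrite -big_seq -natr_sum pnatr_eq0 -lt0n.
have i1 : \1%VF \in weyl_seq by apply/mem_weyl_seq; exact: weyl_id.
have e1 : ((\1^-1)%VF : 'End(E)) = \1%VF by apply: weyl_inv_eq; rewrite comp_lfun1l.
by rewrite (big_rem _ i1) /= e1 id_lfunE eqxx.
Qed.

Lemma rho_dominant : dominant ip Rt Rp rho.
Proof. by apply: dominant_simple; [exact: rho_weight|move=> b bB; rewrite rho_simple]. Qed.

Definition dominated lam : seq E :=
  enum_fset (fset_set [set mu | dominant ip Rt Rp mu /\ dominance_le Rp mu lam]%classic).

Lemma mem_dominated lam mu : dominant ip Rt Rp lam ->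
  (mu \in dominated lam) <-> dominant ip Rt Rp mu /\ dominance_le Rp mu lam.
Proof.
by move=> dl; rewrite -[mu \in _]/(mu \in fset_set _) in_fset_set ?inE//; exact: finite_dominated.
Qed.

(* Each step removes the highest frequency [xi] of [F]; antisymmetry makes [xi]
   strictly dominant, so that [xi = mu + rho] with [mu] dominant. *)
Lemma antisymmetric_division lam F : dominant ip Rt Rp lam ->
  has_spectrum (saturated (lam + rho)) F ->
  (forall b x, b \in B -> F (refl b x) = - F x) ->
  exists a : E -> R[i], forall x, F x = delta x * \sum_(mu <- dominated lam) a mu * mono mu x.
Proof.
move=> dl; set Y := lam + rho.
have wY : weight ip Rt Y by apply: weightD; [case: dl|exact: rho_weight].
have fS : finite_set [set xi | saturated Y xi]%classic.
  apply: finite_saturated => // a aP; rewrite ipDl addr_ge0//; apply: dominant_ge0 => //.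
  exact: rho_dominant.
pose leh (x y : E) := ip x v <= ip y v.
pose s := sort leh (enum_fset (fset_set [set xi | saturated Y xi]%classic)).
have us : uniq s by rewrite sort_uniq fset_uniq.
have ms xi : (xi \in s) <-> saturated Y xi.
  by rewrite mem_sort -[xi \in enum_fset _]/(xi \in fset_set _) in_fset_set// inE.
have ss : sorted leh s by apply: sort_sorted => x y; exact: le_total.
have hts i j : (i <= j)%N -> (j < size s)%N -> leh (nth 0 s i) (nth 0 s j).
  move=> ij js; apply: (sorted_leq_nth _ _ _ ss) => //; rewrite ?inE//.
  - by move=> x y z; exact: le_trans.
  - by move=> x; exact: lexx.
  - exact: leq_ltn_trans js.
have ws xi : xi \in s -> weight ip Rt xi by move=> /ms; exact: saturated_weight.
have sw xi : saturated Y xi -> weight ip Rt xi by exact: saturated_weight.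
(* The induction is on a cut-off [k] in the list sorted by height, beyond which all coefficients of
   [F] vanish. *)
suff H k : forall F, has_spectrum (saturated Y) F ->
    (forall b x, b \in B -> F (refl b x) = - F x) ->
    (forall j, (k <= j < size s)%N -> coef (nth 0 s j) F = 0) ->
    exists a : E -> R[i], forall x, F x = delta x * \sum_(mu <- dominated lam) a mu * mono mu x.
  by move=> Fs Fa; apply: (H (size s)) => // j /andP[/leq_ltn_trans h /h]; rewrite ltnn.
elim: k => [|k IH] {}F Fs Fa F0.
  exists (fun=> 0) => x; rewrite big1 ?mulr0; last by move=> mu _; rewrite mul0r.
  rewrite (spectrum_expand us (fun eta => (ms eta).2) ws Fs) big_seq big1// => xi xis.
  by rewrite -(nth_index 0 xis) F0 ?mul0r//= index_mem.
have [ks|ks] := ltnP k (size s); last first.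
  by apply: IH => // j /andP[kj /leq_trans/(_ ks)]; rewrite ltnNge kj.
set xi := nth 0 s k; have xis : xi \in s by rewrite mem_nth.
have Xxi := (ms xi).1 xis; have wxi := ws _ xis.
have [c0|c0] := eqVneq (coef xi F) 0.
  apply: IH => // j /andP[]; rewrite leq_eqVlt => /predU1P[<- //|kj js].
  by apply: F0; rewrite kj js.
have tF := tame_spectrum Fs.
have cr b : b \in B -> coef (refl b xi) F = - coef xi F.
  move=> bB; have Wb := weyl_reflection (subBR bB).
  have := coef_weyl Wb sw wxi Fs; rewrite (refl_inv (subBR bB)) => <-.
  rewrite -mulN1r -coefZ; last first.
    apply: tame_spectrum (spectrum_weyl Wb (Y := saturated Y) _ Fs) => nu.
    by rewrite (refl_inv (subBR bB)); exact: saturated_weyl.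
  by congr (coef _ _); apply/funext => x; rewrite Fa// mulN1r opprK.
(* If the pairing were 0, the coefficient at [xi] would be its own opposite; if negative, the
   reflected frequency would be higher, with a nonzero coefficient. *)
have xib b : b \in B -> 0 < ip xi (cor b).
  move=> bB; have Wb := weyl_reflection (subBR bB).
  rewrite lt0r; apply/andP; split.
    apply/negP => /eqP z; have := cr b bB; rewrite reflE z scale0r subr0 => /eqP.
    by rewrite -addr_eq0 -mulr2n mulrn_eq0 /= (negPf c0).
  have rs : refl b xi \in s by apply/ms; exact: saturated_weyl.
  have : ip (refl b xi) v <= ip xi v.
    rewrite -(nth_index 0 rs); apply: hts => //; rewrite leqNgt; apply/negP => ki.
    have := cr b bB; rewrite -(nth_index 0 rs) F0 ?ki ?index_mem// => /esym/eqP.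
    by rewrite oppr_eq0 (negPf c0).
  by rewrite reflE ipBl ipZl gerBl pmulr_lge0// pos_ht// subB.
pose mu := xi - rho; have xiE : xi = mu + rho by rewrite subrK.
have dmu : dominant ip Rt Rp mu.
  apply: dominant_simple => [|b bB]; first by apply: weightB => //; exact: rho_weight.
  rewrite ipBl rho_simple// subr_ge0.
  have /intrP[n nE] := wxi b (subBR bB); have := xib b bB.
  by rewrite nE ltr0z -[1]/(1%:~R) ler_int.
have mulam : dominance_le Rp mu lam.
  have := saturated_cone Xxi; rewrite /Y xiE /dominance_le; congr root_cone.
  by rewrite opprD addrACA subrr addr0.
have muD : mu \in dominated lam by apply/mem_dominated.
have gs := dmono_spectrum dmu; rewrite -xiE in gs.
have gsY := spectrum_sub (fun nu => saturated_le (saturated_cone Xxi)) gs.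
have tg := tame_spectrum gs.
have g0 := coef_dmono_neq0 dmu; rewrite -xiE in g0.
set g := fun x => delta x * mono mu x in gs gsY tg g0.
pose q := coef xi F / coef xi g.
have [||j /andP[kj js]|a aE] := IH (fun x => F x + (- q) * g x).
- by apply: spectrumD => //; exact: spectrumZ.
- move=> b x bB; rewrite Fa// /g delta_simple// mono_weyl; last exact/weyl_reflection/subBR.
  by ring.
- rewrite coefD//; last by apply: tameM => //; exact: tame_cst.
  rewrite coefZ//; move: kj; rewrite leq_eqVlt => /predU1P[<-|kj].
    by rewrite -/xi /q mulNr divfK// subrr.
  rewrite F0 ?kj// add0r (coef_notin (X := saturated xi) (f := g)) ?mulr0// => [eta||].
  - exact: saturated_weight.
  - exact: ws (mem_nth 0 js).
  (* Heights may tie: a frequency below [xi] in the dominance order and at least as high as [xi]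
     equals [xi], so subtracting [q * g] creates no term beyond [k]. *)
  move=> /saturated_cone/root_cone_ht0; rewrite ipBl subr_le0 => /(_ (hts k j (ltnW kj) js)).
  by move/eqP; rewrite subr_eq0 nth_uniq// => /eqP kE; rewrite kE ltnn in kj.
exists (fun nu => a nu + (if nu == mu then q else 0)) => x.
have -> : F x = (F x + - q * g x) + q * g x by rewrite mulNr subrK.
rewrite aE /g; under [in RHS]eq_bigr do rewrite mulrDl.
rewrite big_split /= mulrDr; congr (_ + _).
rewrite (bigD1_seq mu)//= ?eqxx; last exact: fset_uniq.
rewrite big1 ?addr0; first by rewrite mulrCA.
by move=> nu /negPf->; rewrite mul0r.
Qed.

(** * Bernstein-Szego polynomials *)

Variables (Ms Ml : nat) (ts : 'I_Ms -> R) (tl : 'I_Ml -> R).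
Hypothesis ts_small : forall m, -1 < ts m < 1.
Hypothesis tl_small : forall m, -1 < tl m < 1.

Local Notation ps := (pos_short ip Rt Rp).
Local Notation pl := (pos_long ip Rt Rp).
Local Notation wC := (weight_C ip Rt Rp ts tl).

Definition C_factors : seq (R * E) :=
  [seq (ts m, a) | a <- ps, m <- index_enum 'I_Ms] ++
  [seq (tl m, a) | a <- pl, m <- index_enum 'I_Ml].

Lemma C_factors_small : small C_factors.
Proof.
move=> p; rewrite mem_cat => /orP[] /allpairsP[[a m] /= [aP _ ->]] /=.
- by split; [exact: ts_small|exact: pos_short_sub].
- by split; [exact: tl_small|exact: pos_long_sub].
Qed.

Lemma weight_CE x : wC x = \prod_(p <- C_factors) (fac p.1 (- p.2) x).
Proof.
rewrite big_cat /= !big_allpairs_dep /=; congr (_ * _); apply: eq_bigr => a _;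
  by apply: eq_bigr => m _; rewrite /expo ipNl.
Qed.

Lemma weight_CN x : wC (- x) = \prod_(p <- C_factors) (fac p.1 p.2 x).
Proof. by rewrite weight_CE; apply: eq_bigr => p _; rewrite expoNr opprK. Qed.

Lemma weight_CJ x : (wC x)^* = wC (- x).
Proof.
rewrite weight_CN weight_CE rmorph_prod; apply: eq_bigr => p _.
rewrite rmorphD rmorph1 rmorphM /= expoJ opprK; congr (1 + _ * _).
exact: conjc_real.
Qed.

Lemma weight_C_neq0 x : wC x != 0.
Proof.
rewrite weight_CE prodf_seq_neq0; apply/allP => p pC; apply/implyP => _.
by apply: fac_neq0; have [] := C_factors_small pC.
Qed.

(** The factors of [a] and [- a] together are even in [a] and depend otherwise only on its length,
    which [W] preserves. *)
Lemma weight_CC_weyl w x : W w -> wC (w x) * wC (- w x) = wC x * wC (- x).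
Proof.
move=> Ww; have Wi := weyl_inv Ww.
pose cs (a : E) y := c_short ts (expi (- ip a y)) * c_short ts (expi (- ip a (- y))).
pose cl (a : E) y := c_long tl (expi (- ip a y)) * c_long tl (expi (- ip a (- y))).
have CE y : wC y * wC (- y) = \prod_(a <- ps) cs a y * \prod_(a <- pl) cl a y.
  by rewrite /weight_C !big_split /=; ring.
have csN a : cs (- a) x = cs a x by rewrite /cs !ipNl !ipNr !opprK mulrC.
have clN a : cl (- a) x = cl a x by rewrite /cl !ipNl !ipNr !opprK mulrC.
rewrite !CE -(big_weyl_even _ Wi pos_short_sub (fun a => pos_short_rabs Wi) csN).
rewrite -(big_weyl_even _ Wi pos_long_sub (fun a => pos_long_rabs Wi) clN).
by congr (_ * _); apply: eq_bigr => a _; rewrite /cs /cl !ipNr ip_weyl.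
Qed.

Definition rhoC : E := \sum_(p <- C_factors) 2^-1 *: p.2.

Lemma rhoCE w : W w -> rhoC = \sum_(p <- C_factors) 2^-1 *: rabs (w p.2).
Proof.
move=> Ww; rewrite /rhoC !big_cat /= !big_allpairs_dep /=.
rewrite -[X in X + _](perm_big _ (perm_rabs Ww pos_short_sub (fun a => pos_short_rabs Ww))).
rewrite -[X in _ + X = _](perm_big _ (perm_rabs Ww pos_long_sub (fun a => pos_long_rabs Ww))).
by rewrite !big_map.
Qed.

(* [M^(s)] or [M^(l)] according to the length of [a]. *)
Definition mult a : R := if short_root ip Rt a then Ms%:R else Ml%:R.

Lemma rhoC_simple b : b \in B -> ip rhoC (cor b) = mult b.
Proof.
move=> bB; have -> : rhoC = halfsum mult.
  have pe : perm_eq ps [seq a <- Rp | short_root ip Rt a].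
    apply: uniq_perm; rewrite ?filter_uniq ?fset_uniq// => a.
    by rewrite mem_filter !inE /= andbC.
  have pe' : perm_eq pl [seq a <- Rp | ~~ short_root ip Rt a].
    apply: uniq_perm; rewrite ?filter_uniq ?fset_uniq// => a.
    rewrite mem_filter !inE /= /long_root andbC.
    by case aP : (a \in Rp); rewrite ?andbF// posR.
  rewrite /rhoC big_cat /= !big_allpairs_dep /= /halfsum [RHS](bigID (short_root ip Rt)) /=.
  rewrite (perm_big _ pe) (perm_big _ pe') !big_filter; congr (_ + _); apply: eq_bigr => a sa.
    by rewrite sumr_const card_ord /mult sa scalerMnl -[in LHS]mulr_natl.
  by rewrite sumr_const card_ord /mult (negPf sa) scalerMnl -[in LHS]mulr_natl.
apply: halfsum_simple => // a aP ab; rewrite /mult.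
have := short_root_rabs (weyl_reflection (subBR bB)) aP.
by rewrite /rabs (simple_perm bB aP ab) => ->.
Qed.

Lemma min_pairing_le (A : {fset E}) lam a c : (c%:E <= min_pairing ip A lam)%E ->
  a \in A -> c <= ip lam (cor a).
Proof.
move=> h aA; move: h; rewrite /min_pairing (big_rem a)//= le_min lee_fin.
by case/andP.
Qed.

(** Origin of the bounds [Ms - 1] and [Ml - 1]: on a simple coroot [rho] gives 1 and [rhoC] gives
    [Ms] or [Ml]. *)
Lemma deep_nat lam : dominant ip Rt Rp lam -> sufficiently_deep ip Rt Rp Ms Ml lam ->
  forall b, b \in B -> ip (lam + rho - rhoC) (cor b) \is a Num.nat.
Proof.
move=> dl [hs hl] b bB; rewrite ipBl ipDl rho_simple// rhoC_simple//.
have := dominant_nat dl bB; have bP := subB bB; rewrite !natrEint => /andP[li _].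
apply/andP; split; first by rewrite rpredB ?rpredD ?rpred1// /mult; case: ifP => _; exact: natr_int.
rewrite /mult; case: ifPn => sb; rewrite subr_ge0 -lerBlDr.
  by apply: min_pairing_le hs _; rewrite !inE /= bP.
by apply: min_pairing_le hl _; rewrite !inE /= bP /long_root sb posR.
Qed.

Lemma expo_sum (T : Type) (r : seq T) (F : T -> E) x :
  expo (\sum_(i <- r) F i) x = \prod_(i <- r) expo (F i) x.
Proof.
elim: r => [|i r IH]; first by rewrite !big_nil expo0.
by rewrite !big_cons expoD IH.
Qed.

Lemma half_prodC x : half_prod C_factors x = expo rhoC x * wC x.
Proof.
rewrite weight_CE /rhoC expo_sum -big_split; apply: eq_bigr => p _ /=.
rewrite mulrDr mulr1 mulrCA -expoD; congr (_ + _ * expo _ _).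
by rewrite -[X in _ - X]scale1r -scalerBl -scaleNr; congr (_ *: _); lra.
Qed.

(* Depth enters here: it makes [lam + rho - rhoC] dominant, and the frequencies
   of [C] are bounded by those of [expo rhoC] up to a Weyl-invariant symmetry. *)
Lemma C_spectrum lam : dominant ip Rt Rp lam -> sufficiently_deep ip Rt Rp Ms Ml lam ->
  has_spectrum (saturated (lam + rho)) (fun x => wC x * expo (lam + rho) x).
Proof.
move=> dl deep; have kn := deep_nat dl deep.
apply: (spectrum_eq (f := fun x => half_prod C_factors x * expo (lam + rho - rhoC) x)).
  move=> x; rewrite half_prodC mulrAC mulrC -expoD; congr (_ * expo _ _).
  by rewrite addrC subrK.
have pC p : p \in C_factors -> p.2 \in Rp by move=> /C_factors_small[].
have [g [gs gE]] := half_prod_spectrum pC.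
have hs : has_spectrum (saturated rhoC) (half_prod C_factors).
  apply: (spectrum_eq (fun x => esym (gE x))).
  have sat nu : half_sums [seq p.2 | p <- C_factors] nu -> saturated rhoC nu.
    move=> h w Ww; rewrite (rhoCE Ww).
    have := half_sums_saturated _ h Ww; rewrite big_map; apply.
    by move=> _ /mapP[p /pC pP ->].
  apply: spectrumD; last by apply: spectrum_sub gs => nu [/sat].
  apply: spectrum_expo; apply: sat.
  elim: (C_factors) => [|p M IHM] /=; first by rewrite big_nil.
  by exists p.2, (\sum_(q <- M) 2^-1 *: q.2); split; rewrite ?big_cons//; left.
apply: (spectrumM _ hs (spectrum_expo (X := saturated (lam + rho - rhoC)) (saturated_self kn))).
by move=> nu eta h1 h2; rewrite -[lam + rho](subrK rhoC) addrC; exact: saturatedD.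
Qed.

(** The sign is taken at [w^-1] to match [delta_weyl]. *)
Definition antisym lam x : R[i] :=
  \sum_(w <- weyl_seq) eps (w^-1)%VF * (wC (w x) * expo (lam + rho) (w x)).

Lemma antisym_simple lam b x : b \in B -> antisym lam (refl b x) = - antisym lam x.
Proof.
move=> bB; have Wb := weyl_reflection (subBR bB); rewrite /antisym.
pose G w : R[i] := eps (w^-1)%VF * (wC (w x) * expo (lam + rho) (w x)).
rewrite -[in RHS](weyl_sum_mulr G Wb) -sumrN; apply: eq_big_seq => w /mem_weyl_seq Ww.
have e : eps ((w \o refl b)^-1)%VF = - eps (w^-1)%VF.
  rewrite weyl_inv_comp// (refl_inv (subBR bB)) (eps_mul Wb (weyl_inv Ww)) eps_simple//.
  by rewrite mulN1r.
by rewrite /G e comp_lfunE mulNr opprK.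
Qed.

Lemma antisym_spectrum lam : dominant ip Rt Rp lam -> sufficiently_deep ip Rt Rp Ms Ml lam ->
  has_spectrum (saturated (lam + rho)) (antisym lam).
Proof.
move=> dl deep; apply: spectrum_sum => w /mem_weyl_seq Ww; apply: spectrumZ.
apply: (spectrum_weyl Ww _ (C_spectrum dl deep)) => nu; apply: saturated_weyl.
exact: weyl_inv.
Qed.

Local Notation Delta := (weight_Delta ip Rt Rp ts tl).

(** [inner_Delta] up to the constant [inner_scale]. *)
Definition pairing f g : R[i] := I (fun x => f x * (g x)^* * Delta x).

Lemma tame_delta : tame delta.
Proof. exact: tame_spectrum delta_spectrum. Qed.

Lemma invr_weight_CN x : (wC (- x))^-1 = poisson C_factors x.
Proof. by rewrite weight_CN -prodfV. Qed.

Lemma tame_invC : tame (fun x => (wC x)^-1).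
Proof.
under [X in tame X]eq_fun do rewrite weight_CE -prodfV.
by apply: tame_prod => p /C_factors_small[p1 _]; exact: tame_facV.
Qed.

Lemma tame_invCN : tame (fun x => (wC (- x))^-1).
Proof.
under [X in tame X]eq_fun do rewrite weight_CN -prodfV.
by apply: tame_prod => p /C_factors_small[p1 _]; exact: tame_facV.
Qed.

Lemma DeltaE x : Delta x = delta x * (delta x)^* * ((wC x)^-1 * (wC (- x))^-1).
Proof. by rewrite /weight_Delta normCK invfM. Qed.

Lemma tame_Delta : tame Delta.
Proof.
rewrite (funext DeltaE).
apply: tameM; last by apply: tameM; [exact: tame_invC|exact: tame_invCN].
by apply: tameM; [|apply: tameJ]; exact: tame_delta.
Qed.

Lemma Delta_ge0 x : 0 <= Delta x.
Proof.
by rewrite /weight_Delta -weight_CJ divr_ge0 ?exprn_ge0// mul_conjC_ge0.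
Qed.

Lemma DeltaJ x : (Delta x)^* = Delta x.
Proof. by apply/CrealP; exact: ger0_real (Delta_ge0 x). Qed.

Lemma tame_pairing f g : tame f -> tame g -> tame (fun x => f x * (g x)^* * Delta x).
Proof. by move=> tf tg; apply: tameM; [apply: tameM => //; exact: tameJ|exact: tame_Delta]. Qed.

Lemma pairingC f g : tame f -> tame g -> pairing g f = (pairing f g)^*.
Proof.
move=> tf tg; rewrite /pairing -torus_meanJ; last exact: tame_pairing.
have cM (y z t : R[i]) : (y * z^* * t)^* = z * y^* * t^*.
  by rewrite !rmorphM /= conjCK [y^* * z]mulrC.
by congr I; apply/funext => x; rewrite cM DeltaJ.
Qed.

Lemma pairingD f1 f2 g z : tame f1 -> tame f2 -> tame g ->
  pairing (fun x => f1 x + z * f2 x) g = pairing f1 g + z * pairing f2 g.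
Proof.
move=> t1 t2 tg; rewrite /pairing -torus_meanZ; last exact: tame_pairing.
rewrite -torus_meanD; first last.
- by apply: tameM; [exact: tame_cst|exact: tame_pairing].
- exact: tame_pairing.
by congr I; apply/funext => x; ring.
Qed.

Lemma pairing_sumr (T : eqType) (r : seq T) (c : T -> R[i]) (F : T -> E -> R[i]) f :
  tame f -> (forall i, i \in r -> tame (F i)) ->
  pairing f (fun x => \sum_(i <- r) c i * F i x) = \sum_(i <- r) (c i)^* * pairing f (F i).
Proof.
move=> tf tF; rewrite /pairing.
have tt i : i \in r -> tame (fun x => f x * (F i x)^* * Delta x).
  by move=> ir; apply: tame_pairing => //; exact: tF.
have e i : i \in r -> (c i)^* * I (fun x => f x * (F i x)^* * Delta x) =
    I (fun x => (c i)^* * (f x * (F i x)^* * Delta x)).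
  by move=> ir; rewrite torus_meanZ//; exact: tt.
rewrite [RHS](eq_big_seq _ e) -torus_mean_sum; last first.
  by move=> i ir; apply: tameM; [exact: tame_cst|exact: tt].
congr I; apply/funext => x; rewrite rmorph_sum mulr_sumr mulr_suml; apply: eq_bigr => i _.
rewrite rmorphM /=; ring.
Qed.

Lemma pairing_ge0 f : 0 <= pairing f f.
Proof. by apply: torus_mean_ge0 => x; rewrite mulr_ge0 ?Delta_ge0// mul_conjC_ge0. Qed.

(* Cauchy-Schwarz for the (a priori only semidefinite) pairing. *)
Lemma pairing_null f g : tame f -> tame g -> pairing f f = 0 -> pairing f g = 0.
Proof.
move=> tf tg ff; set a := pairing f g; pose G := pairing g g.
have G0 : 0 <= G := pairing_ge0 g.
have G1 : 0 < G + 1 by rewrite ltr_wpDl.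
have GJ : G^* = G by apply/CrealP; exact: ger0_real.
(* The minimizing choice would be [- a / G], but [G] may be 0. With [G + 1] the value is still
   negative unless [a = 0]. *)
have [z zE] : exists z, z = - a / (G + 1) by exists (- a / (G + 1)).
have zJ : z^* = - a^* / (G + 1) by rewrite zE rmorphM rmorphN fmorphV rmorphD rmorph1 /= GJ.
have tz : tame (fun x => f x + z * g x).
  by apply: tameD => //; apply: tameM => //; exact: tame_cst.
have e : pairing (fun x => f x + z * g x) (fun x => f x + z * g x) =
    a * a^* * ((G / (G + 1) - 2) / (G + 1)).
  rewrite pairingD// [pairing f (fun _ => _)]pairingC// [pairing g (fun _ => _)]pairingC//.
  rewrite !pairingD// ff -/G [pairing g f]pairingC// -/a add0r.
  have -> : (z * a^*)^* = z^* * a by rewrite rmorphM /= conjCK.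
  have -> : (a + z * G)^* = a^* + z^* * G by rewrite rmorphD rmorphM /= GJ.
  by rewrite zJ zE; field; rewrite gt_eqF.
have := pairing_ge0 (fun x => f x + z * g x); rewrite e.
apply: contraTeq => a0; rewrite lt_geF// pmulr_rlt0; last first.
  by rewrite lt0r mul_conjC_ge0 mul_conjC_eq0 a0.
rewrite pmulr_llt0 ?invr_gt0// subr_lt0 ltr_pdivrMr// mulrDr mulr1.
by rewrite mulr2n mulrDl mul1r -addrA ltrDl ltr_wpDl// ltr0n.
Qed.

Lemma dominance_antisym x y : dominance_le Rp x y -> dominance_le Rp y x -> x = y.
Proof.
move=> xy yx; apply/eqP; rewrite eq_sym -subr_eq0; apply/eqP; apply: root_cone_ht0 => //.
by rewrite -oppr_ge0 -ipNl opprB; exact: root_cone_ht.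
Qed.

Lemma dominance_trans x y z : dominance_le Rp x y -> dominance_le Rp y z -> dominance_le Rp x z.
Proof. by move=> xy yz; rewrite /dominance_le -(subrK y z) -addrA; exact: root_coneD. Qed.

Lemma tame_mono mu : dominant ip Rt Rp mu -> tame (mono mu).
Proof. by move=> dmu; exact: tame_spectrum (mono_spectrum dmu). Qed.

(* Unfolding the antisymmetrizer cancels [delta], and [C] against one of the two
   factors of [Delta], leaving only the geometric series [1 / C (- x)]. *)
Lemma antisym_pairing lam mu f (l : seq (R[i] * E)) : tame f ->
  (forall x, antisym lam x = delta x * f x) ->
  (forall x, delta x * mono mu x = \sum_(p <- l) p.1 * expo p.2 x) ->
  pairing f (mono mu) = \sum_(w <- weyl_seq) \sum_(p <- l)
    (p.1)^* * I (fun x => expo (lam + rho - p.2) (w x) * poisson C_factors (w x)).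
Proof.
move=> tf fE lE.
have tJ w p : w \in weyl_seq ->
    tame (fun x => expo (lam + rho - p) (w x) * poisson C_factors (w x)).
  move=> /mem_weyl_seq Ww; apply: tameM; first exact: tame_expo_weyl.
  exact: tame_poisson_weyl C_factors_small.
transitivity (I (fun x => \sum_(w <- weyl_seq) \sum_(p <- l)
    (p.1)^* * (expo (lam + rho - p.2) (w x) * poisson C_factors (w x)))); last first.
  rewrite torus_mean_sum; last first.
    by move=> w ww; apply: tame_sum => p _; apply: tameM; [exact: tame_cst|exact: tJ].
  apply: eq_big_seq => w ww; rewrite torus_mean_sum; last first.
    by move=> p _; apply: tameM; [exact: tame_cst|exact: tJ].
  by apply: eq_bigr => p _; rewrite torus_meanZ//; exact: tJ.
have cM (y z : R[i]) : (y * z)^* = y^* * z^* by rewrite rmorphM.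
congr I; apply/funext => x.
transitivity (antisym lam x * (delta x * mono mu x)^* * (wC x * wC (- x))^-1).
  by rewrite fE DeltaE cM [in RHS]invfM; ring.
rewrite /antisym !mulr_suml; apply: eq_big_seq => w /mem_weyl_seq Ww.
(* Antisymmetry of [delta * mono mu] moves the whole term to the point [w x]; the two signs multiply
   to 1. *)
have -> : (delta x * mono mu x)^* = eps (w^-1)%VF * (delta (w x) * mono mu (w x))^*.
  by rewrite mono_weyl// delta_weyl// -mulrA [in RHS]cM eps_conj (mulrA (eps _)) eps_sqr mul1r.
rewrite -(weight_CC_weyl x Ww) invfM lE rmorph_sum /=.
transitivity (eps (w^-1)%VF * eps (w^-1)%VF * (wC (w x) / wC (w x)) * (wC (- w x))^-1 *
  expo (lam + rho) (w x) * \sum_(p <- l) (p.1 * expo p.2 (w x))^*); first by ring.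
rewrite eps_sqr divff ?weight_C_neq0// !mul1r mulr_sumr; apply: eq_bigr => p _.
by rewrite invr_weight_CN cM expoJ [in RHS]expoD; ring.
Qed.

(** A frequency [p] of [delta * mono mu] lies below [mu + rho], and it contributes only if it lies
    above [lam + rho]; together these give [lam <= mu]. *)
Lemma antisym_pairing0 lam mu f : dominant ip Rt Rp lam -> dominant ip Rt Rp mu -> tame f ->
  (forall x, antisym lam x = delta x * f x) -> ~ dominance_le Rp lam mu ->
  pairing f (mono mu) = 0.
Proof.
move=> dl dm tf fE nle; have [l [lX lE]] := dmono_spectrum dm.
rewrite (antisym_pairing tf fE lE) big_seq big1// => w /mem_weyl_seq Ww.
rewrite big_seq big1// => p pl; rewrite torus_mean_poisson ?mulr0//.
- exact: C_factors_small.
- have wr := rho_weight; apply: weightB; first by apply: weightD => //; case: dl.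
  by apply: saturated_weight (lX p pl); apply: weightD => //; case: dm.
move=> c; apply: nle; have := root_coneD c (saturated_cone (lX p pl)).
rewrite /dominance_le; congr root_cone.
by rewrite opprB addrC addrA subrK opprD addrACA subrr addr0.
Qed.

(** For [mu = lam] the same two inequalities leave the single frequency [lam + rho], with mean 1.
    Each [w] thus contributes the conjugate of one nonzero coefficient, and the pairing is [|W|]
    times it. *)
Lemma antisym_pairing_neq0 lam f : dominant ip Rt Rp lam -> tame f ->
  (forall x, antisym lam x = delta x * f x) -> pairing f (mono lam) != 0.
Proof.
move=> dl tf fE; have [l [lX lE]] := dmono_spectrum dl.
have wY : weight ip Rt (lam + rho) by apply: weightD; [case: dl|exact: rho_weight].
have lw p : p \in l -> weight ip Rt p.2 by move=> /lX; exact: saturated_weight.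
rewrite (antisym_pairing tf fE lE).
have e w : w \in weyl_seq -> \sum_(p <- l) (p.1)^* *
    I (fun x => expo (lam + rho - p.2) (w x) * poisson C_factors (w x)) =
    (coef (lam + rho) (fun x => delta x * mono lam x))^*.
  move=> /mem_weyl_seq Ww; have -> := funext lE; rewrite coef_list// rmorph_sum /=.
  apply: eq_big_seq => p pl; rewrite rmorphM /=; congr (_ * _).
  case: eqP => [->|ne]; last first.
    rewrite rmorph0 torus_mean_poisson//; first exact: C_factors_small.
      by apply: weightB => //; exact: lw.
    rewrite opprB => c; apply: ne; apply: dominance_antisym; last exact: c.
    exact: saturated_cone (lX p pl).
  rewrite rmorph1 -[RHS](torus_mean_poisson1 Ww C_factors_small); congr I; apply/funext => x.
  by rewrite subrr expo0 mul1r.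
rewrite (eq_big_seq _ e) big_const_seq count_predT iter_addr_0 mulrn_eq0 negb_or.
rewrite conjC_eq0 coef_dmono_neq0// andbT -lt0n.
have : \1%VF \in weyl_seq by apply/mem_weyl_seq; exact: weyl_id.
by case: (weyl_seq).
Qed.

Lemma fset_set_sumE (A : set E) (F : E -> R[i]) : finite_set A ->
  \sum_(mu \in A) F mu = \sum_(mu <- enum_fset (fset_set A)) F mu.
Proof. exact: fsbig_finite. Qed.

Definition inner_scale : R[i] :=
  (#|` fset_set (weyl_group ip Rt)|%:R * torus_volume ip Rt)^-1 * ((torus_density ip Rt)%:C)%C.

Lemma inner_DeltaE f g : inner_Delta ip Rt Rp ts tl f g = inner_scale * pairing f g.
Proof. by rewrite /inner_Delta /torus_integral mulrA. Qed.

Lemma bernstein_szegoE lam p : dominant ip Rt Rp lam -> inner_scale != 0 ->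
  bernstein_szego ip Rt Rp ts tl lam p ->
  (exists a, a lam = 1 /\ p =1 fun x => \sum_(mu <- dominated lam) a mu * mono mu x) /\
  forall mu, dominant ip Rt Rp mu -> dominance_lt Rp mu lam -> pairing p (mono mu) = 0.
Proof.
move=> dl K0 [[a [a1 pE]] orth]; split.
  exists a; split=> // x; rewrite pE fset_set_sumE//; exact: finite_dominated.
move=> mu dmu lt; have /eqP := orth mu dmu lt.
by rewrite inner_DeltaE mulf_eq0 (negPf K0) => /eqP.
Qed.

Lemma tame_dominated_sum lam (a : E -> R[i]) : dominant ip Rt Rp lam ->
  tame (fun x => \sum_(mu <- dominated lam) a mu * mono mu x).
Proof.
move=> dl; apply: (tame_sum (F := fun mu x => a mu * mono mu x)) => mu.
by move=> /(mem_dominated _ dl)[dm _]; apply: tameM; [exact: tame_cst|exact: tame_mono].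
Qed.

(* [d = a lam * p - f], with [f] the quotient of the antisymmetrized product by
   [delta], only involves weights strictly below [lam] and is orthogonal to all
   of them, hence is null: [f] is proportional to [p], with a nonzero factor. *)
Lemma deep_pairing0 lam mu p : dominant ip Rt Rp lam -> dominant ip Rt Rp mu ->
  sufficiently_deep ip Rt Rp Ms Ml lam -> inner_scale != 0 ->
  bernstein_szego ip Rt Rp ts tl lam p -> ~ dominance_le Rp lam mu ->
  pairing p (mono mu) = 0.
Proof.
move=> dl dm deep K0 bs nle.
have [[a [a1 /funext pE]] orth] := bernstein_szegoE dl K0 bs.
have [a' gE] := antisymmetric_division dl (antisym_spectrum dl deep) (antisym_simple lam).
set f := fun x => \sum_(mu <- dominated lam) a' mu * mono mu x in gE.
have tf : tame f by exact: tame_dominated_sum.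
have tp' : tame p by rewrite pE; exact: tame_dominated_sum.
pose d x := - f x + a' lam * p x.
have dpair nu : dominant ip Rt Rp nu ->
    pairing d (mono nu) = - pairing f (mono nu) + a' lam * pairing p (mono nu).
  move=> dn; have tn := tame_mono dn; rewrite /d pairingD//; last first.
    by under [X in tame X]eq_fun do rewrite -mulN1r; apply: tameM => //; exact: tame_cst.
  congr (_ + _); rewrite /pairing -mulN1r -torus_meanZ; last exact: tame_pairing.
  by congr I; apply/funext => x; ring.
have td : tame d.
  apply: tameD; last by apply: tameM => //; exact: tame_cst.
  by under [X in tame X]eq_fun do rewrite -mulN1r; apply: tameM => //; exact: tame_cst.
have dE : d = fun x => \sum_(nu <- dominated lam) (a' lam * a nu - a' nu) * mono nu x.
  apply/funext => x; rewrite /d pE /f mulr_sumr addrC -sumrB; apply: eq_bigr => nu _.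
  by rewrite mulrBl mulrA.
have dd : pairing d d = 0.
  rewrite {2}dE pairing_sumr//; last by move=> nu /(mem_dominated _ dl)[dn _]; exact: tame_mono.
  rewrite big_seq big1// => nu /(mem_dominated _ dl)[dn le].
  have [->|ne] := eqVneq nu lam; first by rewrite a1 mulr1 subrr rmorph0 mul0r.
  rewrite dpair// orth//; last by split=> //; exact/eqP.
  rewrite (antisym_pairing0 dl dn tf gE) ?oppr0 ?mulr0 ?addr0 ?mulr0//.
  by move=> le'; move: ne; rewrite (dominance_antisym le le') eqxx.
have dnull nu : dominant ip Rt Rp nu -> a' lam * pairing p (mono nu) = pairing f (mono nu).
  move=> dn; have := pairing_null td (tame_mono dn) dd; rewrite dpair// => /eqP.
  by rewrite addrC subr_eq0 => /eqP.
have a0 : a' lam != 0.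
  apply: contraNneq (antisym_pairing_neq0 dl tf gE) => z.
  by rewrite -dnull// z mul0r.
apply: (mulfI a0); rewrite mulr0 dnull//; exact: antisym_pairing0 dl dm tf gE nle.
Qed.

(** Both orders of the arguments are concluded because either weight of the theorem may be the deep
    one. *)
Lemma deep_orthogonal lam mu p q : dominant ip Rt Rp lam -> dominant ip Rt Rp mu ->
  sufficiently_deep ip Rt Rp Ms Ml lam -> inner_scale != 0 ->
  bernstein_szego ip Rt Rp ts tl lam p -> bernstein_szego ip Rt Rp ts tl mu q ->
  mu <> lam -> pairing p q = 0 /\ pairing q p = 0.
Proof.
move=> dl dm deep K0 bp bq ne.
have [[a [a1 /funext pE]] porth] := bernstein_szegoE dl K0 bp.
have [[c [c1 /funext qE]] qorth] := bernstein_szegoE dm K0 bq.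
have tp' : tame p by rewrite pE; exact: tame_dominated_sum.
have tq : tame q by rewrite qE; exact: tame_dominated_sum.
suff z : pairing p q = 0 by rewrite (pairingC tp' tq) z rmorph0.
(* If [lam <= mu], expand [p]: its weights lie strictly below [mu], where [q] is orthogonal.
   Otherwise expand [q]: none of its weights is above [lam]. *)
have [le|nle] := pselect (dominance_le Rp lam mu).
  apply/eqP; rewrite -conjC_eq0 -pairingC// pE pairing_sumr//; last first.
    by move=> nu /(mem_dominated _ dl)[dn _]; exact: tame_mono.
  rewrite big_seq big1// => nu /(mem_dominated _ dl)[dn nul]; rewrite qorth ?mulr0//.
  split; first exact: dominance_trans nul le.
  by move=> nm; apply: ne; apply: dominance_antisym le; rewrite -nm.
rewrite qE pairing_sumr//; last by move=> nu /(mem_dominated _ dm)[dn _]; exact: tame_mono.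
rewrite big_seq big1// => nu /(mem_dominated _ dm)[dn num].
rewrite (deep_pairing0 dl dn deep K0 bp) ?mulr0// => le.
by apply: nle; exact: dominance_trans le num.
Qed.

End RootSystem.

Theorem theorem2p2 (R : realType) (E : vectType R) (ip : {dot E for idfun})
  (Rt Rp : {fset E}) (Ms Ml : nat) (ts : 'I_Ms -> R) (tl : 'I_Ml -> R)
  (lam mu : E) (p_lam p_mu : E -> R[i]) :
  root_system ip Rt ->
  irreducible_roots ip Rt ->
  positive_roots ip Rt Rp ->
  (forall m, -1 < ts m < 1 /\ ts m != 0) ->
  (forall m, -1 < tl m < 1 /\ tl m != 0) ->
  dominant ip Rt Rp lam ->
  dominant ip Rt Rp mu ->
  bernstein_szego ip Rt Rp ts tl lam p_lam ->
  bernstein_szego ip Rt Rp ts tl mu p_mu ->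
  sufficiently_deep ip Rt Rp Ms Ml lam \/
    sufficiently_deep ip Rt Rp Ms Ml mu ->
  mu <> lam ->
  inner_Delta ip Rt Rp ts tl p_lam p_mu = 0.
Proof.
move=> rsys _ [v [v_regular RpE]] hs hl dl dm bl bm deep ne.
have hs' m : -1 < ts m < 1 by case: (hs m).
have hl' m : -1 < tl m < 1 by case: (hl m).
(* [fset_set] of an infinite set is empty, so the normalization would contain the inverse of 0,
   which is 0. *)
have [fW|nfW] := pselect (finite_set (weyl_group ip Rt)); last first.
  by rewrite /inner_Delta /fset_set; case: pselect => // _; rewrite cardfs0 mul0r invr0 mul0r.
have [B baseB] := base_exists Rp.
rewrite inner_DeltaE; have [->|K0] := eqVneq (inner_scale ip Rt) 0; first by rewrite mul0r.
case: deep => deep.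
  have [-> _] := deep_orthogonal rsys v_regular RpE baseB fW hs' hl' dl dm deep K0 bl bm ne.
  by rewrite mulr0.
have ne' : lam <> mu by move=> e; apply: ne.
have [_ ->] := deep_orthogonal rsys v_regular RpE baseB fW hs' hl' dm dl deep K0 bm bl ne'.
by rewrite mulr0.
Qed.
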